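(* Consider the iterates generated for $k=0,1,2,\dots$ by $$u^{k+1}=F(x^k)+\alpha\rho_{k+1}\bigl(F(x^k)-F(x^{k-1})\bigr),\qquad x^{k+1}=\operatorname{prox}_{\gamma_{k+1}g}\bigl(x^k-\gamma_{k+1}u^{k+1}\bigr),\qquad\rho_{k+1}=\tfrac{\gamma_{k+1}}{\gamma_k},$$ for some $\alpha\in[1,2]$ and $\gamma_k>0$. Suppose that $\gamma_{k+1}=\rho_{k+1}\gamma_k$ is selected such that $A_{k+1},B_{k+1},C_{k+1}\ge0$ for all $k\in\mathbb N$, where $A_{k+1},B_{k+1},C_{k+1}$ are the coefficients defined in the context for some $\varepsilon,\mu,\lambda>0$. Then, for any solution $x^\star$ of $0\in F(x)+\partial g(x)$ the following hold: 1. $0\le\mathcal U^\alpha_{k+1}(x^\star)\le\mathcal U^\alpha_k(x^\star)$, $k\in\mathbb N$, and in particular $(x^k)$ is bounded. 2. $\displaystyle0\le\min_{k\le K}V_k(x^\star)\le\frac{\mathcal U^\alpha_1(x^\star)}{\sum_{k=1}^{K+1}\gamma_k}$. 3. If $\sum_{k\in\mathbb N}\gamma_k=\infty$, then $\liminf_{k\to\infty}V_k(x^\star)=0$ and any cluster point of the (bounded) ergodic sequence $$\bar x^K:=\frac{\sum_{k=2}^K\alpha\gamma_k\bigl(\frac1\alpha+\rho_k-\rho_{k+1}^2\bigr)x^{k-1}+(1+\alpha\rho_{K+1})\gamma_{K+1}x^K}{\sum_{k=2}^K\alpha\gamma_k\bigl(\frac1\alpha+\rho_k-\rho_{k+1}^2\bigr)+(1+\alpha\rho_{K+1})\gamma_{K+1}}$$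 solves $0\in F(x)+\partial g(x)$. Moreover, $$\operatorname{Gap}_{x^\star,\delta}(\bar x^K)\le\frac{\sup\{\mathcal U^\alpha_2(x):x\in\operatorname{dom}g\cap B(x^\star;\delta)\}}{\sum_{k=1}^K\gamma_{k+1}}$$ holds for all $K\ge1$ with $\delta=\sup_{k\in\mathbb N}\|x^k-x^\star\|$. 4. Under the stronger condition that $\inf_{k\in\mathbb N}\gamma_k>0$, then $V_k(x^\star)\to0$; if $\liminf_{k\to\infty}C_k>0$ also holds, then $x^k$ converges to a solution $x^\infty$ with $\mathcal U^\alpha_k(x^\infty)\to0$.
   Context: Standing assumptions: $F:\mathbb R^n\to\mathbb R^n$ is monotone and locally Lipschitz continuous; $g:\mathbb R^n\to\mathbb R\cup\{+\infty\}$ is proper, convex and lower semicontinuous; $\operatorname{zer}T=\{x:0\in F(x)+\partial g(x)\}\neq\emptyset$. The starting data $x^{-2},x^{-1},x^0\in\mathbb R^n$ and $\gamma_0,\rho_0>0$ are given. $\operatorname{prox}_{\gamma g}(y)=\arg\min_z\{g(z)+\frac1{2\gamma}\|z-y\|^2\}$. Notation: $\Delta_x^k:=x^k-x^{k-1}$, $\Delta_F^k:=F(x^k)-F(x^{k-1})$; $[t]_-:=\max\{-t,0\}$; $L_k:=\|\Delta_F^k\|/\|\Delta_x^k\|$, $\ell_k:=\langle\Delta_F^k,\Delta_x^k\rangle/\|\Delta_x^k\|^2$; every quotient $\frac00$ is set to $0$; for $x\in\operatorname{dom}g$, $V_k(x):=g(x^k)-g(x)-\langle F(x^k),x-x^k\rangle$,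 and $$\mathcal U^\alpha_k(x):=\tfrac12\|x^k-x\|^2+\tfrac12\|\Delta_x^k\|^2+\tfrac{\lambda(\gamma_k\rho_k)^2}2\|\Delta_F^{k-1}\|^2+(1+\alpha\rho_k)\gamma_kV_{k-1}(x),$$ with values in $\mathbb R\cup\{+\infty\}$. The coefficients are $$\begin{aligned} A_{k+1}&=\tfrac1\alpha+\rho_k-\rho_{k+1}^2,\\ B_{k+1}&=\tfrac{\lambda}{2\alpha^2}-\rho_{k+1}^2\Bigl(1+\tau_k\tfrac{2-\alpha}{2\alpha\varepsilon}+\tfrac{[\cos\phi_k]_-}{\mu}\Bigr),\\ C_{k+1}&=\tfrac12-(\gamma_{k+1}L_k)^2\Bigl(\tfrac\lambda2\rho_{k+1}^2+(1+\alpha\rho_{k+1})^2\bigl(1+\mu[\cos\phi_k]_-\bigr)\Bigr)+\Bigl(\alpha-1+2\gamma_k\ell_k-\tau_k\alpha\varepsilon\tfrac{2-\alpha}2\Bigr)\rho_{k+1}^2, \end{aligned}$$ $$\tau_k:=\frac{\langle\Delta_x^k,\Delta_F^{k-1}\rangle}{\frac{\varepsilon}{2\gamma_k\rho_k}\|\Delta_x^k\|^2+\frac{\rho_k\gamma_k}{2\varepsilon}\|\Delta_F^{k-1}\|^2},\qquad\cos\phi_k:=\frac{\langle\Delta_F^k,\Delta_F^{k-1}\rangle}{\|\Delta_F^k\|\|\Delta_F^{k-1}\|}.$$ The restricted gap function centered at $x^\star\in\operatorname{zer}T$ with radius $\delta>0$ is $$\operatorname{Gap}_{x^\star,\delta}(y):=\sup_{x\in\operatorname{dom}g\cap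 B(x^\star;\delta)}\{\langle F(x),y-x\rangle+g(y)-g(x)\},$$ where $B(x^\star;\delta)$ is the closed ball of center $x^\star$ and radius $\delta$.
   Formalization: In item 1, U_{k+1}(x* ) ≤ U_k(x* ) is proved for all k ≥ 1, but for k = 0 only if x^0 is itself the prox step from x^{-1}, x^{-2} with γ_0, ρ_0; for arbitrary starting data the k = 0 inequality is false (F = 0, g = 10|·|, x^{-2} = x^{-1} = 0, x^0 = 1). *)

(* Defs.v *)
(* MathComp-Analysis, over an arbitrary R : realType. *)
From HB Require Import structures.
From mathcomp Require Import all_boot all_order all_algebra.
From mathcomp Require Import all_classical all_reals all_analysis.

Set Implicit Arguments.
Unset Strict Implicit.
Unset Printing Implicit Defensive.

Import Order.TTheory GRing.Theory Num.Theory.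
Import numFieldNormedType.Exports.
Local Open Scope classical_set_scope.
Local Open Scope ring_scope.

(* The library norm on 'rV[R]_n is the sup norm. It is used below only through
   the topology, boundedness and local Lipschitz continuity, none of which
   depends on the norm; every quantitative expression uses enorm. *)
Section Euclidean.
Variables (R : realType) (n : nat).
Implicit Types u v : 'rV[R]_n.

Definition dotp u v : R := \sum_(i < n) u 0 i * v 0 i.

Definition enorm u : R := Num.sqrt (dotp u u).

Definition ecball (c : 'rV[R]_n) (delta : R) : set 'rV[R]_n :=
  [set z | enorm (z - c) <= delta].

End Euclidean.

Section Problem.
Variables (R : realType) (n : nat).
Variables (F : 'rV[R]_n -> 'rV[R]_n) (g : 'rV[R]_n -> \bar R).

Definition monotone_op := forall y z, 0 <= dotp (F y - F z) (y - z).

Definition locally_lipschitz :=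
  forall y : 'rV[R]_n, exists2 U : set 'rV[R]_n, nbhs y U & [lipschitz F z | z in U].

Definition edom : set 'rV[R]_n := [set y | (g y < +oo)%E].

(* The first conjunct says that g takes its values in R u {+oo}. *)
Definition proper_fun := (forall y, (-oo < g y)%E) /\ edom !=set0.

(* At t = 0 and t = 1 this uses the convention 0 * +oo = 0 of \bar R. *)
Definition econvex := forall (y z : 'rV[R]_n) (t : R), 0 <= t <= 1 ->
  (g (t *: y + (1 - t) *: z) <= t%:E * g y + (1 - t)%:E * g z)%E.

Definition subdifferential (y : 'rV[R]_n) : set 'rV[R]_n :=
  [set v | forall z, (g y + (dotp v (z - y))%:E <= g z)%E].

Definition zerT : set 'rV[R]_n :=
  [set y | [set F y + v | v in subdifferential y] 0].

Definition prox_obj (c : R) (y z : 'rV[R]_n) : \bar R :=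
  (g z + ((2 * c)^-1 * enorm (z - y) ^+ 2)%:E)%E.

(* The argmin set; it is a singleton when g is proper, convex and lower
   semicontinuous, so z = prox is rendered as membership. *)
Definition prox (c : R) (y : 'rV[R]_n) : set 'rV[R]_n :=
  [set z | forall w, (prox_obj c y z <= prox_obj c y w)%E].

(* Gap xs delta y, restricted gap function centered at xs. *)
Definition Gap (xs : 'rV[R]_n) (delta : R) (y : 'rV[R]_n) : \bar R :=
  ereal_sup [set ((dotp (F z) (y - z))%:E + g y - g z)%E
            | z in edom `&` ecball xs delta].

End Problem.

Definition negpart (R : realType) (t : R) : R := Num.max (- t) 0.

(* Iterates are indexed by int so that x^{-2} and x^{-1} make sense; the values
   below index -2 are never used. The step sizes gamma_k and ratios rho_k are
   indexed by nat. In all quotients below the convention 0/0 = 0 is the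
   library's t / 0 = 0, since a vanishing denominator forces a vanishing
   numerator. *)
Section Iterates.
Variables (R : realType) (n : nat).
Variables (F : 'rV[R]_n -> 'rV[R]_n) (g : 'rV[R]_n -> \bar R).
Variable x : int -> 'rV[R]_n.
Variables gamma rho : nat -> R.
Variables alpha eps mu lambda : R.
Implicit Types (j : int) (k : nat).

Definition dx j : 'rV[R]_n := x j - x (j - 1).
Definition dF j : 'rV[R]_n := F (x j) - F (x (j - 1)).

Definition uk k : 'rV[R]_n :=
  F (x (k%:Z - 1)) + (alpha * rho k) *: (F (x (k%:Z - 1)) - F (x (k%:Z - 2))).

(* x^k is obtained from x^{k-1} and x^{k-2} by one step of the method. *)
Definition prox_step k :=
  prox g (gamma k) (x (k%:Z - 1) - gamma k *: uk k) (x k%:Z).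

Definition L_ k : R := enorm (dF k%:Z) / enorm (dx k%:Z).

Definition ell_ k : R := dotp (dF k%:Z) (dx k%:Z) / enorm (dx k%:Z) ^+ 2.

Definition tau k : R :=
  dotp (dx k%:Z) (dF (k%:Z - 1)) /
  (eps / (2 * gamma k * rho k) * enorm (dx k%:Z) ^+ 2 +
   rho k * gamma k / (2 * eps) * enorm (dF (k%:Z - 1)) ^+ 2).

Definition cosphi k : R :=
  dotp (dF k%:Z) (dF (k%:Z - 1)) / (enorm (dF k%:Z) * enorm (dF (k%:Z - 1))).

(* Acoef k, Bcoef k, Ccoef k stand for A_{k+1}, B_{k+1}, C_{k+1}. *)
Definition Acoef k : R := alpha^-1 + rho k - rho k.+1 ^+ 2.

Definition Bcoef k : R :=
  lambda / (2 * alpha ^+ 2) -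
  rho k.+1 ^+ 2 *
    (1 + tau k * ((2 - alpha) / (2 * alpha * eps)) + negpart (cosphi k) / mu).

Definition Ccoef k : R :=
  2^-1 -
  (gamma k.+1 * L_ k) ^+ 2 *
    (lambda / 2 * rho k.+1 ^+ 2 +
     (1 + alpha * rho k.+1) ^+ 2 * (1 + mu * negpart (cosphi k))) +
  (alpha - 1 + 2 * gamma k * ell_ k - tau k * alpha * eps * ((2 - alpha) / 2)) *
    rho k.+1 ^+ 2.

(* Meant for z in edom g. *)
Definition Vk j (z : 'rV[R]_n) : \bar R :=
  (g (x j) - g z - (dotp (F (x j)) (z - x j))%:E)%E.

Definition Uk k (z : 'rV[R]_n) : \bar R :=
  ((2^-1 * enorm (x k%:Z - z) ^+ 2 + 2^-1 * enorm (dx k%:Z) ^+ 2 +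
    lambda * (gamma k * rho k) ^+ 2 / 2 * enorm (dF (k%:Z - 1)) ^+ 2)%:E +
   ((1 + alpha * rho k) * gamma k)%:E * Vk (k%:Z - 1) z)%E.

Definition minV K (z : 'rV[R]_n) : \bar R :=
  \big[Order.min/+oo%E]_(k < K.+1) Vk (k : nat)%:Z z.

Definition xbar K : 'rV[R]_n :=
  (\sum_(2 <= k < K.+1) (alpha * gamma k * Acoef k) +
     (1 + alpha * rho K.+1) * gamma K.+1)^-1 *:
  (\sum_(2 <= k < K.+1) (alpha * gamma k * Acoef k) *: x (k%:Z - 1) +
     ((1 + alpha * rho K.+1) * gamma K.+1) *: x K%:Z).

End Iterates.

(* Main.v *)
(* The optimality conditions of two consecutive prox steps give the descent
   U_{k+1}(z) + alpha gamma_k A_{k+1} V_{k-1}(z) + loss_k <= U_k(z) for every z in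
   dom g, where loss_k >= 0 collects all the slack of the estimate. Telescoping,
   with sum_{m <= k < N} alpha gamma_k A_{k+1} + (1 + alpha rho_N) gamma_N
   = sum_{m <= k <= N} gamma_k + alpha rho_m gamma_m, yields the rates; Jensen's
   inequality and Minty's lemma give the ergodic statement.

   V_k(xs) -> 0 does not follow from the descent alone, since A_{k+1} may vanish.
   Let p_k be the subgradient of g at x^k produced by the prox step,
   f_k = F(x^k) - F(x^{k-1}) and r_k = p_k + F(x^k), so that
   V_k(xs) <= <r_k, x^k - xs>. When gamma_k is bounded below, loss_k -> 0 forces
   p_{k+1} - p_k -> 0, <x^k - x^{k-1}, f_k> / gamma_k -> 0,
   alpha rho_k <f_k, f_{k-1}> <= o(1) and
   |x^k - x^{k-1}|^2 / gamma_k^2 <= K |f_k|^2 + o(1).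
   The first three give |r_{k+1}|^2 >= |r_k|^2 + |f_{k+1}|^2 - o(1), the last one
   |r_k|^2 <= K' (|f_k|^2 + |f_{k+1}|^2) + o(1). Hence |r_k|^2 would grow
   geometrically if it did not tend to 0, while it is bounded. *)
Require Import Defs.
From mathcomp Require Import all_boot all_order all_algebra.
From mathcomp Require Import all_classical all_reals all_analysis.
From mathcomp Require Import ring lra.
Import Order.TTheory GRing.Theory Num.Theory.
Import numFieldNormedType.Exports.
Local Open Scope classical_set_scope.
Local Open Scope ring_scope.

(** * The Euclidean norm *)

Section EuclideanSpace.
Context {R : realType} {n : nat}.
Implicit Types u v w : 'rV[R]_n.

Lemma dotpC u v : dotp u v = dotp v u.
Proof. by apply: eq_bigr => i _; rewrite mulrC. Qed.

Lemma dotpDl u v w : dotp (u + v) w = dotp u w + dotp v w.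
Proof. by rewrite -big_split; apply: eq_bigr => i _; rewrite mxE mulrDl. Qed.

Lemma dotpDr u v w : dotp u (v + w) = dotp u v + dotp u w.
Proof. by rewrite dotpC dotpDl !(dotpC u). Qed.

Lemma dotpZl a u v : dotp (a *: u) v = a * dotp u v.
Proof. by rewrite mulr_sumr; apply: eq_bigr => i _; rewrite mxE mulrA. Qed.

Lemma dotpZr a u v : dotp u (a *: v) = a * dotp u v.
Proof. by rewrite dotpC dotpZl dotpC. Qed.

Lemma dotpNl u v : dotp (- u) v = - dotp u v.
Proof. by rewrite -scaleN1r dotpZl mulN1r. Qed.

Lemma dotpNr u v : dotp u (- v) = - dotp u v.
Proof. by rewrite dotpC dotpNl dotpC. Qed.

Definition dotpE := (dotpDl, dotpDr, dotpNl, dotpNr, dotpZl, dotpZr).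

Lemma dotp0r u : dotp u 0 = 0.
Proof. by rewrite -(scale0r (0 : 'rV[R]_n)) dotpZr mul0r. Qed.

Lemma dotp_suml (I : Type) (s : seq I) (q : I -> 'rV[R]_n) v :
  dotp (\sum_(i <- s) q i) v = \sum_(i <- s) dotp (q i) v.
Proof.
elim/big_rec2: _ => [|i a b _ <-]; first by rewrite dotpC dotp0r.
by rewrite dotpDl.
Qed.

Lemma dotp_ge0 u : 0 <= dotp u u.
Proof. by apply: sumr_ge0 => i _; rewrite -expr2 sqr_ge0. Qed.

Lemma enorm_ge0 u : 0 <= enorm u.
Proof. exact: sqrtr_ge0. Qed.

Lemma sqr_enorm u : enorm u ^+ 2 = dotp u u.
Proof. by rewrite sqr_sqrtr// dotp_ge0. Qed.

Lemma enorm_eq0 u : enorm u = 0 -> u = 0.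
Proof.
move=> u0; have := sqr_enorm u; rewrite u0 expr0n /= => /esym/eqP.
rewrite psumr_eq0; last by move=> i _; rewrite -expr2 sqr_ge0.
move=> /allP h; apply/rowP => i; rewrite mxE.
have /= := h i (mem_index_enum i).
by rewrite -expr2 sqrf_eq0 => /eqP.
Qed.

Lemma enorm0 : enorm (0 : 'rV[R]_n) = 0.
Proof. by rewrite /enorm dotp0r sqrtr0. Qed.

Lemma enormZ a u : enorm (a *: u) = `|a| * enorm u.
Proof.
rewrite /enorm dotpZl dotpZr mulrA -expr2 sqrtrM ?sqr_ge0//.
by rewrite sqrtr_sqr.
Qed.

Lemma enormN u : enorm (- u) = enorm u.
Proof. by rewrite -scaleN1r enormZ normrN1 mul1r. Qed.

(** Cauchy-Schwarz: expand [|enorm v *: u - enorm u *: v|^2 >= 0] and cancel [enorm u * enorm v],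
    once the cases of a zero norm are removed. *)
Lemma dotp_le u v : dotp u v <= enorm u * enorm v.
Proof.
have [v0|v0] := eqVneq (enorm v) 0.
  by rewrite (enorm_eq0 v v0) dotp0r enorm0 mulr0.
have vp : 0 < enorm v by rewrite lt_def v0 enorm_ge0.
have [u0|u0] := eqVneq (enorm u) 0.
  by rewrite (enorm_eq0 u u0) dotpC dotp0r enorm0 mul0r.
have up : 0 < enorm u by rewrite lt_def u0 enorm_ge0.
have := dotp_ge0 (enorm v *: u - enorm u *: v).
rewrite !dotpE -!sqr_enorm (dotpC v u) => h.
rewrite -(ler_pM2l (mulr_gt0 up vp)).
nra.
Qed.

Lemma norm_dotp_le u v : `|dotp u v| <= enorm u * enorm v.
Proof. by rewrite ler_norml -lerN2 opprK -dotpNl -{1}(enormN u) !dotp_le. Qed.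

Lemma enormD u v : enorm (u + v) <= enorm u + enorm v.
Proof.
rewrite -(@ler_pXn2r _ 2) ?nnegrE ?addr_ge0 ?enorm_ge0//.
rewrite sqr_enorm !dotpE (dotpC v u) -!sqr_enorm.
by have := dotp_le u v; nra.
Qed.

Lemma enormB u v : enorm (u - v) <= enorm u + enorm v.
Proof. by rewrite -(enormN v); exact: enormD. Qed.

(** This bound and the next make the two norms equivalent, so that topological facts about the sup
    norm carry over to [enorm]. *)
Lemma norm_le_enorm u : `|u| <= enorm u.
Proof.
rewrite [`|u|]mx_normrE; apply: bigmax_le; first exact: enorm_ge0.
move=> -[i j] _ /=; rewrite ord1 -sqrtr_sqr ler_wsqrtr//.
rewrite /dotp (bigD1 j)//= -expr2 lerDl.
by apply: sumr_ge0 => k _; rewrite -expr2 sqr_ge0.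
Qed.

Lemma enorm_le_norm u : enorm u <= Num.sqrt n%:R * `|u|.
Proof.
rewrite -[X in _ * X]ger0_norm// -sqrtr_sqr -sqrtrM ?ler0n// ler_wsqrtr//.
rewrite -[X in X%:R]card_ord mulr_natl -sumr_const; apply: ler_sum => i _.
have h : `|u 0 i| <= `|u|.
  by rewrite [leRHS]mx_normrE (le_bigmax _ (fun ij => `|u ij.1 ij.2|) (0, i)).
by rewrite -expr2 -(real_normK (num_real (u 0 i))) lerXn2r ?nnegrE.
Qed.

End EuclideanSpace.

(** * Convex functions and proximal points *)

(** Letting [t] tend to 0 from above. It serves to differentiate convexity inequalities along
    segments. *)
Lemma le_of_le_small {R : realType} (a b K : R) :
  (forall t, 0 < t -> t <= 1 -> a <= b + t * K) -> a <= b.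
Proof.
move=> h; apply/ler_addgt0Pr => e e0.
have K1 : 0 < `|K| + 1 by rewrite ltr_wpDl.
pose t := Num.min 1 (e / (`|K| + 1)).
have t0 : 0 < t by rewrite lt_min ltr01 divr_gt0.
apply: (le_trans (h t t0 _)); first by rewrite ge_min lexx.
rewrite lerD2l; apply: (@le_trans _ _ (t * (`|K| + 1))).
  by rewrite ler_pM2l// (le_trans (ler_norm K))// lerDl.
by rewrite -ler_pdivlMr// ge_min lexx orbT.
Qed.

Section ConvexFunctions.
Context {R : realType} {n : nat} {g : 'rV[R]_n -> \bar R}.
Hypotheses (g_proper : proper_fun g) (g_convex : econvex g).

Lemma edom_fineK {y} : edom g y -> (fine (g y))%:E = g y.
Proof.
case: g_proper => gNy _ gy; rewrite fineK// fin_numElt gy andbT; exact: gNy.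
Qed.

Lemma edom_EFin {y r} : (g y <= r%:E)%E -> edom g y.
Proof. by move=> /le_lt_trans; apply; exact: ltry. Qed.

Lemma convex_fine {y z t} : edom g y -> edom g z -> 0 <= t <= 1 ->
  (g (t *: y + (1 - t) *: z) <= (t * fine (g y) + (1 - t) * fine (g z))%:E)%E.
Proof.
move=> gy gz t01; rewrite EFinD !EFinM !edom_fineK//; exact: g_convex.
Qed.

Lemma subgradient_edom {y v} : subdifferential g y v -> edom g y.
Proof.
case: g_proper => _ [z gz] /(_ z) h; have := le_lt_trans h gz.
by rewrite /edom /=; case: (g y) => // r _; exact: ltry.
Qed.

Lemma subgradient_fine {y z v} : subdifferential g y v -> edom g z ->
  fine (g y) + dotp v (z - y) <= fine (g z).
Proof.
move=> yv gz; have := yv z.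
by rewrite -(edom_fineK gz) -(edom_fineK (subgradient_edom yv)) -EFinD lee_fin.
Qed.

(** Fermat's rule: compare [p] with the point [t *: z + (1 - t) *: p] of the segment towards [z],
    use convexity of [g], divide by [t] and let [t] tend to 0. *)
Lemma prox_subgradient {c y p} : 0 < c -> prox g c y p ->
  subdifferential g p (c^-1 *: (y - p)).
Proof.
move=> c0 pP; case: (g_proper) => gNy [z0 gz0].
(* The objective at [p] is at most its finite value at a point of the domain. *)
have gp : edom g p.
  have := le_lt_trans (pP z0) (_ : (_ < +oo)%E); rewrite /prox_obj /edom /=.
  rewrite -(edom_fineK gz0) -EFinD ltry => /(_ isT).
  by case: (g p) => // r _; exact: ltry.
move=> z; have [->|] := eqVneq (g z) +oo%E; first by rewrite leey.
rewrite -ltey => gz; rewrite -(edom_fineK gz) -(edom_fineK gp) -EFinD lee_fin.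
set Gz := fine (g z); set Gp := fine (g p).
rewrite -lerBrDl.
apply: (@le_of_le_small _ _ _ ((2 * c)^-1 * dotp (z - p) (z - p))) => t t0 t1.
have := le_trans (pP (t *: z + (1 - t) *: p))
  (leeD (convex_fine gz gp _) (lexx _)).
rewrite (ltW t0) t1 => /(_ isT); rewrite /prox_obj -(edom_fineK gp).
rewrite -!EFinD lee_fin !sqr_enorm -/Gz -/Gp.
have -> : t *: z + (1 - t) *: p - y = (p - y) + t *: (z - p).
  by rewrite scalerBl scale1r scalerBr; apply/rowP => i; rewrite !mxE; ring.
have -> : y - p = - (p - y) by rewrite opprB.
move: (p - y) (z - p) => a b; rewrite !dotpE (dotpC b a) => h.
rewrite -(ler_pM2l t0).
have ci : (2 * c)^-1 * 2 = c^-1 by rewrite invfM mulrAC mulVf ?mul1r// pnatr_eq0.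
move: h; rewrite -ci /= -/Gp; move: ((2 * c)^-1) => k; nra.
Qed.

(* [wmean S Y H] says that [g (Y / S) <= H / S], except in the empty case, so
   that convex combinations can be built up one term at a time. *)
Definition wmean (S : R) (Y : 'rV[R]_n) (H : R) :=
  S = 0 /\ Y = 0 /\ H = 0 \/ 0 < S /\ (g (S^-1 *: Y) <= (S^-1 * H)%:E)%E.

(** The new mean is the convex combination of the old mean and [q] with coefficients [S / (S + w)]
    and [w / (S + w)]. *)
Lemma wmean_add S Y H w q : wmean S Y H -> 0 <= w -> edom g q ->
  wmean (S + w) (Y + w *: q) (H + w * fine (g q)).
Proof.
move=> SYH; rewrite le_eqVlt => /predU1P[<- gq|w0 gq].
  by rewrite scale0r mul0r !addr0.
right; case: SYH => [[-> [-> ->]]|[S0 gY]].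
  rewrite !add0r; split=> //.
  by rewrite scalerA mulrA mulVf ?gt_eqF// scale1r mul1r edom_fineK.
have Sw : 0 < S + w by exact: addr_gt0.
split=> //; set t := S / (S + w).
have t1 : 1 - t = w / (S + w) by rewrite /t; field; rewrite gt_eqF.
have -> : (S + w)^-1 *: (Y + w *: q) = t *: (S^-1 *: Y) + (1 - t) *: q.
  rewrite t1 /t scalerDr !scalerA; congr (_ *: _ + _ *: _).
    by rewrite mulrAC mulfV ?mul1r// gt_eqF.
  by rewrite mulrC.
apply: (le_trans (convex_fine (edom_EFin gY) gq _)).
  apply/andP; split; first by rewrite divr_ge0// ltW.
  by rewrite ler_pdivrMr// mul1r lerDl ltW.
rewrite lee_fin t1 /t mulrDr lerD//; last by rewrite mulrCA mulrA mulrAC mulrC.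
have := gY; rewrite -(edom_fineK (edom_EFin gY)) lee_fin => h.
have -> : (S + w)^-1 * H = S / (S + w) * (S^-1 * H).
  by field; rewrite !gt_eqF.
by rewrite ler_wpM2l// divr_ge0// ltW.
Qed.

(** Jensen's inequality for finitely many nonnegative weights; a vanishing total weight falls under
    the empty case of [wmean]. *)
Lemma wmean_sum (s : seq nat) (w : nat -> R) (q : nat -> 'rV[R]_n) :
  (forall i, i \in s -> 0 <= w i /\ edom g (q i)) ->
  wmean (\sum_(i <- s) w i) (\sum_(i <- s) w i *: q i)
    (\sum_(i <- s) w i * fine (g (q i))).
Proof.
elim: s => [_|i s ih h]; first by rewrite !big_nil; left.
have [wi gi] := h i (mem_head _ _).
rewrite !big_cons [X in wmean X]addrC [X in wmean _ X]addrC.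
rewrite [X in wmean _ _ X]addrC.
apply: wmean_add => //; apply: ih => j js.
by apply: h; rewrite in_cons js orbT.
Qed.

End ConvexFunctions.

(** * Cluster points and zeros of [F + subdifferential g] *)

Section EuclideanTopology.
Context {R : realType} {n : nat}.
Implicit Types (y : 'rV[R]_n) (q : nat -> 'rV[R]_n) (F : 'rV[R]_n -> 'rV[R]_n).

Lemma nbhs_enorm y e : 0 < e -> nbhs y [set a : 'rV[R]_n | enorm (a - y) < e].
Proof.
move=> e0; have s0 : 0 <= Num.sqrt n%:R :> R by exact: sqrtr_ge0.
apply/(@nbhs_normP R 'rV[R]_n); exists (e / (Num.sqrt n%:R + 1)) => /=.
  by rewrite divr_gt0// ltr_wpDl.
move=> a /= ya; apply: (le_lt_trans (enorm_le_norm _)); rewrite distrC.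
apply: (@le_lt_trans _ _ ((Num.sqrt n%:R + 1) * `|y - a|)).
  by rewrite ler_wpM2r// lerDl.
by rewrite mulrC -ltr_pdivlMr// ltr_wpDl.
Qed.

Lemma cluster_seqE {q y} {U : set 'rV[R]_n} (N : nat) :
  cluster (q @ \oo) y -> nbhs y U -> exists2 k, (N <= k)%N & U (q k).
Proof.
move=> qy yU; have := qy [set q k | k in [set k | (N <= k)%N]] U _ yU.
case=> [|_ [[k Nk <-]]]; last by exists k.
by exists N => //= k Nk; exists k.
Qed.

(** Bolzano-Weierstrass, from compactness of closed sup-norm balls. *)
Lemma bounded_seq_cluster {q M} : (forall k, enorm (q k) <= M) ->
  exists y, cluster (q @ \oo) y.
Proof.
move=> qM; pose A : set 'rV[R]_n := closed_ball_ (fun a => `|a|) 0 M.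
have cA : closed A by exact: closed_closed_ball_.
have bA : bounded_set A.
  rewrite /= /bounded_near; near=> r => a /=.
  rewrite /A /closed_ball_/= sub0r normrN => /le_trans; apply.
  by near: r; apply: nbhs_pinfty_ge; exact: num_real.
case: (bounded_closed_compact bA cA (F := q @ \oo)) => [|y [_ ?]].
  exists 0%N => //= k _; rewrite /A /closed_ball_/= sub0r normrN.
  exact: le_trans (norm_le_enorm _) (qM k).
by exists y.
Unshelve. all: by end_near. Qed.

Lemma locally_lipschitz_enorm F y : locally_lipschitz F ->
  exists K e : R, [/\ 0 <= K, 0 < e &
    forall a, enorm (a - y) < e -> enorm (F a - F y) <= K * enorm (a - y)].
Proof.
move=> /(_ y)[U yU] /pinfty_ex_gt0[K K0 FK].
have /(@nbhs_normP R 'rV[R]_n)[e /= e0 eU] := yU.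
have s0 : 0 <= Num.sqrt n%:R :> R by exact: sqrtr_ge0.
exists (Num.sqrt n%:R * K), e; split=> //; first by rewrite mulr_ge0// ltW.
move=> a ay; apply: (le_trans (enorm_le_norm _)); rewrite -mulrA ler_wpM2l//.
have Ua : U a.
  by apply: eU => /=; rewrite distrC (le_lt_trans (norm_le_enorm _)).
have := FK (a, y) (conj Ua (nbhs_singleton yU)); rewrite /= => /le_trans; apply.
by rewrite ler_wpM2l ?norm_le_enorm// ltW.
Qed.

(** Otherwise the ball contains points [q k] with [enorm (F (q k)) > k]. They cluster at some [y],
    near which [F] is bounded by its Lipschitz estimate. *)
Lemma locally_lipschitz_bounded F B : locally_lipschitz F ->
  exists M, forall a, enorm a <= B -> enorm (F a) <= M.
Proof.
move=> FL; apply: contrapT => /forallNP unb.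
have {}unb (k : nat) : exists a, enorm a <= B /\ k%:R < enorm (F a).
  have /existsNP[a /not_implyP[aB aF]] := unb k%:R.
  by exists a; split => //; rewrite real_ltNge ?num_real//; exact/negP.
pose q k := projT1 (cid (unb k)).
have qB k : enorm (q k) <= B by have [] := projT2 (cid (unb k)).
have qF k : k%:R < enorm (F (q k)) by have [] := projT2 (cid (unb k)).
have [y qy] := bounded_seq_cluster qB.
have [K [e [K0 e0 FK]]] := locally_lipschitz_enorm F y FL.
have [k Nk /= ke] := cluster_seqE
  (Num.truncn (K * e + enorm (F y))).+1 qy (nbhs_enorm y e e0).
have h : enorm (F (q k)) <= K * e + enorm (F y).
  rewrite -{1}(subrK (F y) (F (q k))) (le_trans (enormD _ _))// lerD2r.
  by rewrite (le_trans (FK _ ke))// ler_wpM2l// ltW.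
have := lt_le_trans (qF k) h; apply/negP; rewrite -leNgt.
apply: (@le_trans _ _ (Num.truncn (K * e + enorm (F y))).+1%:R).
  by rewrite ltW// truncnS_gt.
by rewrite ler_nat.
Qed.

(** Minty's lemma. The hypothesis evaluates [F] only at the fixed [z], so lower semicontinuity of
    [g] is enough to pass to the cluster point. Testing the limit inequality at points [w] of the
    segment from [y] to [z], and letting [w] tend to [y], replaces [F w] by [F y]. *)
Lemma cluster_zerT F (g : 'rV[R]_n -> \bar R) q y :
  locally_lipschitz F -> proper_fun g -> econvex g ->
  lower_semicontinuous g -> cluster (q @ \oo) y ->
  (forall z, edom g z -> exists2 err : nat -> R, err @ \oo --> 0 &
    \forall k \near \oo,
      (g (q k) + (dotp (F z) (q k - z))%:E <= g z + (err k)%:E)%E) ->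
  zerT F g y.
Proof.
move=> FL gp gc glsc qy qz.
have minty z : edom g z -> (g y + (dotp (F z) (y - z))%:E <= g z)%E.
  move=> gz; have [err err0 errP] := qz z gz; rewrite leNgt.
  rewrite -(edom_fineK gp gz); apply/negP => lt_gz.
  pose c := fine (g z) - dotp (F z) (y - z).
  have cy : (c%:E < g y)%E by rewrite /c EFinB lteBlDr.
  (* A real [a] strictly between [c] and [g y], which may be [+oo]. Half of the gap [a - c] absorbs
     the error [err k], the other half the change of the linear term. *)
  have [a ca ya] : exists2 a : R, c < a & (a%:E < g y)%E.
    move: cy; case: (g y) => [r|_|//]; last first.
      by exists (c + 1); rewrite ?ltry// ltrDl.
    rewrite lte_fin => cr; exists ((c + r) / 2); rewrite ?lte_fin;
      by rewrite (midf_lt cr).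
  have [V yV Va] := glsc y a ya.
  have ac2 : 0 < (a - c) / 2 by rewrite divr_gt0// subr_gt0.
  pose e := (a - c) / 2 / (enorm (F z) + 1).
  have Fz1 : 0 < enorm (F z) + 1 by rewrite ltr_wpDl ?enorm_ge0.
  have e0 : 0 < e by rewrite divr_gt0.
  have [N _ NP] : \forall k \near \oo, err k < (a - c) / 2 /\
      (g (q k) + (dotp (F z) (q k - z))%:E <= g z + (err k)%:E)%E.
    near=> k; split; last by near: k.
    by near: k; exact: (cvgr_lt 0).
  have [k Nk [/Va aqk /= qke]] :=
    cluster_seqE N qy (filterI yV (nbhs_enorm y e e0)).
  have [errk] := NP k Nk.
  rewrite -(edom_fineK gp gz); apply/negP; rewrite -ltNge.
  rewrite -EFinD -lteBlDr// -EFinB; apply: le_lt_trans aqk; rewrite lee_fin.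
  have Fq : - dotp (F z) (q k - y) <= (a - c) / 2.
    rewrite -dotpNl (le_trans (dotp_le _ _))// enormN.
    apply: (@le_trans _ _ ((enorm (F z) + 1) * enorm (q k - y))).
      by rewrite ler_wpM2r ?enorm_ge0// lerDl.
    by rewrite mulrC -ler_pdivlMr// ltW.
  have -> : q k - z = (q k - y) + (y - z) by rewrite addrA subrK.
  by rewrite dotpDr; move: Fq errk; rewrite /c; lra.
have gy : edom g y.
  case: (gp) => _ [z gz]; have := minty z gz.
  rewrite -(edom_fineK gp gz) /edom /=; case: (g y) => // r _; exact: ltry.
exists (- F y); last by rewrite subrr.
move=> z; have [->|] := eqVneq (g z) +oo%E; first by rewrite leey.
rewrite -ltey => gz; rewrite -(edom_fineK gp gz) -(edom_fineK gp gy).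
rewrite -EFinD lee_fin dotpNl.
have [K [e [K0 e0 FK]]] := locally_lipschitz_enorm F y FL.
set v := z - y; have v0 := enorm_ge0 v.
have [M1 M1v M10] : exists2 M, enorm v <= M & 0 < M.
  by exists (enorm v + 1); rewrite ?lerDl// ltr_wpDl.
rewrite lerBlDl.
(* The scale [t0] keeps [w] within the Lipschitz radius [e] of [y] for all [t <= t0]; the positive
   bound [M1] replaces [enorm v], which may vanish. *)
pose t0 := Num.min 1 (e / (2 * M1)).
apply: (@le_of_le_small _ _ _ (t0 * (K * enorm v * enorm v))) => s s0 s1.
pose t := s * t0.
have t00 : 0 < t0 by rewrite lt_min ltr01 divr_gt0// mulr_gt0.
have tp : 0 < t by rewrite mulr_gt0.
have t0le1 : t0 <= 1 by rewrite ge_min lexx.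
have t0le : t0 <= e / (2 * M1) by rewrite ge_min lexx orbT.
have t01 : t <= 1 by rewrite mulr_ile1// ltW.
have te : t * enorm v < e.
  apply: (@le_lt_trans _ _ (t0 * M1)).
    by rewrite ler_pM// ?(ltW tp)// ler_piMl// ltW.
  apply: (@le_lt_trans _ _ (e / (2 * M1) * M1)).
    by rewrite ler_wpM2r// ltW.
  rewrite invfM mulrA -mulrA mulVf ?gt_eqF// mulr1.
  by rewrite ltr_pdivrMr// ltr_pMr// ltr1n.
pose w := t *: z + (1 - t) *: y.
have wy : w - y = t *: v.
  by apply/rowP => i; rewrite !mxE; ring.
have gw := convex_fine gp gc gz gy (_ : 0 <= t <= 1).
rewrite (ltW tp) t01 in gw; have {}gw := gw isT; rewrite -/w in gw.
have := le_trans (minty w (edom_EFin gw)) gw.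
rewrite -(edom_fineK gp gy) -EFinD lee_fin -opprB wy dotpNr dotpZr => h.
have Fw : enorm (F w - F y) <= K * (t * enorm v).
  have := FK w; rewrite wy enormZ gtr0_norm//; exact.
have Fwv : dotp (F w) v <= dotp (F y) v + K * (t * enorm v) * enorm v.
  rewrite -lerBlDl -dotpNl -dotpDl (le_trans (dotp_le _ _))//.
  by rewrite ler_wpM2r.
rewrite mulrA -/t -(ler_pM2l tp).
move: h; rewrite /=; set gy' := fine (g y); set gz' := fine (g z) => h.
have := ler_wpM2l (ltW tp) Fwv; move: h.
lra.
Unshelve. all: by end_near. Qed.

End EuclideanTopology.

(** * Null sequences of reals *)

Lemma cvg0_le {R : realType} (u v : nat -> R) :
  (\forall k \near \oo, `|u k| <= v k) -> v @ \oo --> 0 -> u @ \oo --> 0.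
Proof.
move=> uv /cvgrPdist_lt v0; apply/cvgrPdist_lt => e e0.
near=> k; rewrite sub0r normrN.
apply: (@le_lt_trans _ _ (v k)); first by near: k.
apply: le_lt_trans (ler_norm _) _; rewrite -normrN -sub0r.
by near: k; exact: v0.
Unshelve. all: by end_near. Qed.

(* Otherwise [a] would grow by a fixed amount every second step. *)
Lemma growth_cvg0 {R : realType} (a err : nat -> R) (M kap : R) : 0 < kap ->
  (\forall k \near \oo, 0 <= a k <= M) -> err @ \oo --> 0 ->
  (\forall k \near \oo, (1 + kap) * a k - err k <= a k.+2) -> a @ \oo --> 0.
Proof.
move=> kap0 aM err0 grow; apply/cvgrPdist_lt => e e0.
(* While [a k >= e], the gain [kap * a k] is at least [kap * e]. An error below half of that leaves
   a net growth of [kap * e / 2]. *)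
have ke : 0 < kap * e / 2 by rewrite divr_gt0// mulr_gt0.
have [N _ NP] : \forall k \near \oo, [/\ 0 <= a k <= M,
    (1 + kap) * a k - err k <= a k.+2 & err k < kap * e / 2].
  near=> k; split; [by near: k|by near: k|].
  by near: k; exact: (cvgr_lt 0).
near=> k; rewrite sub0r normrN.
have Nk : (N <= k)%N by near: k; exact: nbhs_infty_ge.
have [/andP[ak0 _] _ _] := NP k Nk; rewrite ger0_norm// ltNge; apply/negP => eak.
have up m : e + m%:R * (kap * e / 2) <= a (k + m.*2)%N.
  elim: m => [|m ih]; first by rewrite mul0r addr0 addn0.
  have [_ + errk] := NP (k + m.*2)%N (leq_trans Nk (leq_addr _ _)).
  rewrite doubleS !addnS; apply: le_trans.
  have h : e <= a (k + m.*2)%N.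
    by apply: le_trans ih; rewrite lerDl mulr_ge0// ltW.
  have : kap * e <= kap * a (k + m.*2)%N by rewrite ler_pM2l.
  rewrite -natr1; lra.
pose m := (Num.truncn (`|M| / (kap * e / 2))).+1.
have [/andP[_ aM'] _ _] := NP (k + m.*2)%N (leq_trans Nk (leq_addr _ _)).
have := le_trans (up m) aM'; apply/negP; rewrite -ltNge.
apply: (le_lt_trans (ler_norm M)); apply: ltr_wpDl; first exact: ltW.
by rewrite -ltr_pdivrMr// truncnS_gt.
Unshelve. all: by end_near. Qed.

Lemma cvg0D {R : realType} (u v : nat -> R) :
  u @ \oo --> 0 -> v @ \oo --> 0 -> (fun k => u k + v k) @ \oo --> 0.
Proof. by move=> u0 v0; rewrite -[X in _ --> X]addr0; exact: cvgD. Qed.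

Lemma cvg0Z {R : realType} (c : R) (u : nat -> R) :
  u @ \oo --> 0 -> (fun k => c * u k) @ \oo --> 0.
Proof. by move=> u0; rewrite -(mulr0 c); apply: cvgM => //; exact: cvg_cst. Qed.

Lemma cvg0S {R : realType} (u : nat -> R) :
  u @ \oo --> 0 -> (fun k => u k.+1) @ \oo --> 0.
Proof. by move=> u0; rewrite (cvg_shiftS u). Qed.

Lemma cvg0_sqrt {R : realType} (u : nat -> R) :
  u @ \oo --> 0 -> (fun k => Num.sqrt (u k)) @ \oo --> 0.
Proof.
move=> u0; rewrite -[X in _ --> X]sqrtr0.
by apply: (cvg_comp _ _ u0); exact: sqrt_continuous.
Qed.

(** The lower limit is the supremum of the tail infima, so one of them is positive; it is not [+oo]
    because [u] is real-valued. *)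
Lemma limn_einf_gt0 {R : realType} (u : nat -> R) :
  (0 < limn_einf (fun k => (u k)%:E))%E ->
  exists2 c, 0 < c & \forall k \near \oo, c <= u k.
Proof.
rewrite limn_einf_lim (cvg_lim _ (@cvg_einfs_sup R _))//.
move=> /ereal_sup_gt[_ [m _ <-]] m0.
have le_m k : (m <= k)%N -> (einfs (fun k => (u k)%:E) m <= (u k)%:E)%E.
  by move=> mk; apply: ereal_inf_lbound; exists k.
move: m0 le_m; case: (einfs _ m) => [c| |] // c0 le_m; last first.
  by have := le_m m (leqnn m).
by exists c => //; exists m => // k mk; rewrite -lee_fin le_m.
Qed.

(** * Descent *)

(* One step in coordinates: [e = x^k - z], [d], [d'] are consecutive increments
   of [x], [f1], [f] the corresponding increments of [F], [G = F (x^{k-1})] and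
   [p], [p'] the subgradients of [g] produced by the prox steps. *)
Lemma one_step_bound {R : realType} {n : nat} (e d d' f f1 G p p' w : 'rV[R]_n)
    (alpha lambda gam rho gam' rho' g' g0 g1 gz V0 V1 : R) :
  0 < alpha -> 0 < gam -> 0 < gam' -> gam' = rho' * gam -> 0 <= alpha * rho' * gam' ->
  gam *: p = - d - gam *: G - (gam * (alpha * rho)) *: f1 ->
  gam' *: p' = - d' - gam' *: (G + f) - (gam' * (alpha * rho')) *: f ->
  w = rho' *: d - (gam' * (1 + alpha * rho')) *: f + (gam' * alpha * rho) *: f1 ->
  V1 = g1 - gz - dotp G (d - e) -> V0 = g0 - gz - dotp (G + f) (- e) ->
  g' + dotp p' (- (e + d')) <= gz -> g0 + dotp p d' <= g' ->
  g0 + dotp p (- d) <= g1 -> 0 <= dotp (p' - p) d' ->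
  2^-1 * dotp (e + d') (e + d') + 2^-1 * dotp d' d' +
    lambda * (gam' * rho') ^+ 2 / 2 * dotp f f + (1 + alpha * rho') * gam' * V0 +
  (alpha * gam * (alpha^-1 + rho - rho' ^+ 2) * V1 +
   gam' ^+ 2 * dotp (p' - p) (p' - p) +
   (2^-1 * dotp d d + lambda * (gam * rho) ^+ 2 / 2 * dotp f1 f1 -
    lambda * (gam' * rho') ^+ 2 / 2 * dotp f f - dotp w w +
    alpha * rho' ^+ 2 * dotp d d + alpha ^+ 2 * rho * rho' * gam' * dotp d f1))
  <= 2^-1 * dotp e e + 2^-1 * dotp d d +
     lambda * (gam * rho) ^+ 2 / 2 * dotp f1 f1 + (1 + alpha * rho) * gam * V1.
Proof.
move=> a0 g0p g1p gE ag pE p'E wE -> -> h1 h2 h3 h4.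
(* Scaling the optimality condition of the first step by [rho'] and subtracting it from that of the
   second cancels [G]. This is where the form of [w] comes from. *)
have wE2 : w - d' = gam' *: (p' - p).
  rewrite scalerBr p'E wE {1}gE; move: pE => /(congr1 ( *:%R rho')).
  rewrite scalerA -gE => ->; rewrite gE; apply/rowP => i; rewrite !mxE; ring.
have h4' : 0 <= dotp (w - d') d' by rewrite wE2 dotpZl mulr_ge0// ltW.
have h5 : gam' ^+ 2 * dotp (p' - p) (p' - p) = dotp (w - d') (w - d').
  by rewrite wE2 dotpZl dotpZr expr2 mulrA.
have h6 : dotp w d' = dotp w w - dotp (w - d') (w - d') - dotp (w - d') d'.
  by rewrite !dotpE (dotpC d' w); ring.
(* The three subgradient inequalities enter with weights [gam'], [gam'] and [alpha * rho' * gam']: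
   at [x^{k+1}] tested at [z], at [x^k] tested at [x^{k+1}], and at [x^k] tested at [x^{k-1}]. *)
have k1 : gam' * g' + dotp (gam' *: p') (- (e + d')) <= gam' * gz.
  by rewrite dotpZl -mulrDr ler_wpM2l// ltW.
have k2 : gam' * g0 + rho' * dotp (gam *: p) d' <= gam' * g'.
  by rewrite dotpZl mulrA -gE -mulrDr ler_wpM2l// ltW.
have r'0 : 0 < rho' by move: g1p; rewrite gE pmulr_lgt0.
have k3 : (alpha * rho' * gam') * g0 + alpha * rho' ^+ 2 * dotp (gam *: p) (- d)
    <= (alpha * rho' * gam') * g1.
  rewrite dotpZl.
  have -> : alpha * rho' ^+ 2 * (gam * dotp p (- d)) =
    (alpha * rho' * gam') * dotp p (- d) by rewrite gE; ring.
  by rewrite -mulrDr ler_wpM2l.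
have h7 : dotp w d' = rho' * dotp d d' - gam' * (1 + alpha * rho') * dotp f d' +
    gam' * alpha * rho * dotp f1 d' by rewrite wE !dotpE.
have -> : alpha * gam * (alpha^-1 + rho - rho' ^+ 2) =
    gam + alpha * gam * (rho - rho' ^+ 2) by field; rewrite gt_eqF.
rewrite h5; move: k1 k2 k3 h4' h6; rewrite {}p'E {}pE {}h7.
move: (dotp w w) (dotp (w - d') _) (dotp (w - d') d') => W1 W2 W3.
rewrite !dotpE (dotpC d' e) (dotpC f e) (dotpC G e) (dotpC f d').
rewrite (dotpC f1 d) (dotpC G d) (dotpC G d') (dotpC f1 d') gE.
lra.
Qed.

(** The slack of the one-step bound, sorted into the coefficients [C_{k+1}] of [|d|^2] and [B_{k+1}]
    of [|f1|^2], a monotonicity term and a cross term. The amounts with factor [cn] taken out of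
    both coefficients are given back in the cross term. *)
Lemma coefficients_identity {R : realType} {n : nat} (d f f1 w : 'rV[R]_n)
    (alpha eps mu lambda gam rho gam' rho' L ell tau cn : R) :
  0 < alpha -> 0 < eps -> 0 < mu -> gam' = rho' * gam ->
  w = rho' *: d - (gam' * (1 + alpha * rho')) *: f + (gam' * alpha * rho) *: f1 ->
  L ^+ 2 * dotp d d = dotp f f -> ell * dotp d d = dotp d f ->
  tau * (eps / 2 * dotp d d + (rho * gam) ^+ 2 / (2 * eps) * dotp f1 f1) =
    gam * rho * dotp d f1 ->
  2^-1 * dotp d d + lambda * (gam * rho) ^+ 2 / 2 * dotp f1 f1 -
    lambda * (gam' * rho') ^+ 2 / 2 * dotp f f - dotp w w +
    alpha * rho' ^+ 2 * dotp d d + alpha ^+ 2 * rho * rho' * gam' * dotp d f1 =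
  (2^-1 - (gam' * L) ^+ 2 *
     (lambda / 2 * rho' ^+ 2 + (1 + alpha * rho') ^+ 2 * (1 + mu * cn)) +
   (alpha - 1 + 2 * gam * ell - tau * alpha * eps * ((2 - alpha) / 2)) *
    rho' ^+ 2) * dotp d d +
  (alpha * (gam * rho)) ^+ 2 * (lambda / (2 * alpha ^+ 2) -
    rho' ^+ 2 * (1 + tau * ((2 - alpha) / (2 * alpha * eps)) + cn / mu)) *
    dotp f1 f1 +
  2 * alpha * rho' ^+ 3 * gam * dotp d f +
  (2 * gam' ^+ 2 * (1 + alpha * rho') * (alpha * rho) * dotp f f1 +
   cn * (mu * (gam' * (1 + alpha * rho')) ^+ 2 * dotp f f +
         (gam' * (alpha * rho)) ^+ 2 / mu * dotp f1 f1)).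
Proof.
move=> a0 e0 m0 -> -> Lf elld tauE.
have a00 : alpha != 0 by rewrite gt_eqF.
have e00 : eps != 0 by rewrite gt_eqF.
have m00 : mu != 0 by rewrite gt_eqF.
(* The defining relation of [tau] splits the remaining multiple of [<d, f1>] into a share of
   [|d|^2], charged to [C], and a share of [|f1|^2], charged to [B]. *)
have dfE : alpha * (2 - alpha) * rho' ^+ 2 * (gam * rho * dotp d f1) =
  tau * alpha * eps * ((2 - alpha) / 2) * rho' ^+ 2 * dotp d d +
  (alpha * (gam * rho)) ^+ 2 * (rho' ^+ 2 *
    (tau * ((2 - alpha) / (2 * alpha * eps)))) * dotp f1 f1.
  by rewrite -tauE; field; rewrite ?a00 ?e00.
rewrite !dotpE (dotpC f d) (dotpC f1 d) (dotpC f1 f) -Lf.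
rewrite -elld.
apply/eqP; rewrite -subr_eq0; apply/eqP.
transitivity (- (alpha * (2 - alpha) * rho' ^+ 2 * (gam * rho * dotp d f1)) + (
  tau * alpha * eps * ((2 - alpha) / 2) * rho' ^+ 2 * dotp d d +
  (alpha * (gam * rho)) ^+ 2 * (rho' ^+ 2 *
    (tau * ((2 - alpha) / (2 * alpha * eps)))) * dotp f1 f1)).
  by field; rewrite ?a00 ?e00 ?m00.
by rewrite dfE addNr.
Qed.

Lemma negpart_ge0 {R : realType} (t : R) : 0 <= negpart t.
Proof. by rewrite /negpart le_max lexx orbT. Qed.

(** For [c < 0] the sum is the square [- c (mu P |f| - Q |f1|)^2 / mu]: Young's inequality with
    parameter [mu]. *)
Lemma cross_term_ge0 {R : realType} {n : nat} (f f1 : 'rV[R]_n) (P Q c mu : R) :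
  0 <= P -> 0 <= Q -> 0 < mu -> dotp f f1 = c * (enorm f * enorm f1) ->
  0 <= 2 * P * Q * dotp f f1 +
    negpart c * (mu * P ^+ 2 * dotp f f + Q ^+ 2 / mu * dotp f1 f1).
Proof.
move=> P0 Q0 m0 ->; rewrite -!sqr_enorm /negpart.
move: (enorm f) (enorm f1) (enorm_ge0 f) (enorm_ge0 f1) => a b a0 b0.
have [c0|c0] := leP (- c) 0.
  have c0' : 0 <= c by rewrite -oppr_le0.
  by rewrite mul0r addr0 !mulr_ge0.
have -> : 2 * P * Q * (c * (a * b)) +
    - c * (mu * P ^+ 2 * a ^+ 2 + Q ^+ 2 / mu * b ^+ 2) =
    - c * (mu * P * a - Q * b) ^+ 2 / mu by field; rewrite gt_eqF.
apply: mulr_ge0; last by rewrite invr_ge0 ltW.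
by rewrite mulr_ge0 ?sqr_ge0// ltW.
Qed.

(** * The iterates: optimality conditions, quotients and the descent inequality *)

Section Method.
Context {R : realType} {n : nat}.
Context (F : 'rV[R]_n -> 'rV[R]_n) (g : 'rV[R]_n -> \bar R).
Context (x : int -> 'rV[R]_n) (gamma rho : nat -> R).
Context (alpha eps mu lambda : R).
Hypotheses (F_mono : monotone_op F) (F_lip : locally_lipschitz F).
Hypotheses (g_proper : proper_fun g) (g_convex : econvex g).
Hypothesis g_lsc : lower_semicontinuous g.
Hypotheses (alpha_ge1 : 1 <= alpha) (alpha_le2 : alpha <= 2).
Hypotheses (eps_gt0 : 0 < eps) (mu_gt0 : 0 < mu) (lambda_gt0 : 0 < lambda).
Hypotheses (gamma_gt0 : forall k, 0 < gamma k) (rho0_gt0 : 0 < rho 0%N).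
Hypothesis rhoE : forall k, rho k.+1 = gamma k.+1 / gamma k.
Hypothesis x_step : forall k, prox_step F g x gamma rho alpha k.+1.
Hypothesis A_ge0 : forall k, 0 <= Acoef rho alpha k.
Hypothesis B_ge0 : forall k, 0 <= Bcoef F x gamma rho alpha eps mu lambda k.
Hypothesis C_ge0 : forall k, 0 <= Ccoef F x gamma rho alpha eps mu lambda k.

Local Notation xn k := (x k%:Z).
Local Notation d k := (dx x k%:Z).
Local Notation f k := (dF F x k%:Z).
Local Notation f1 k := (dF F x (k%:Z - 1)).
Local Notation A := (Acoef rho alpha).
Local Notation B := (Bcoef F x gamma rho alpha eps mu lambda).
Local Notation C := (Ccoef F x gamma rho alpha eps mu lambda).

(* [Vr] and [Ur] are meaningful only where [g (x j)], resp. [g (x (k - 1))], is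
   finite: nothing prevents [x (-1)] and [x 0] from lying outside [edom g]. *)
Definition Vr (j : int) z :=
  fine (g (x j)) - fine (g z) - dotp (F (x j)) (z - x j).

Definition Ur k z :=
  2^-1 * enorm (xn k - z) ^+ 2 + 2^-1 * enorm (d k) ^+ 2 +
  lambda * (gamma k * rho k) ^+ 2 / 2 * enorm (f1 k) ^+ 2 +
  (1 + alpha * rho k) * gamma k * Vr (k%:Z - 1) z.

(** The vector [p_k] of the overview, with which the optimality condition of the prox step reads
    [sg k \in subdifferential g (x^k)]. *)
Definition sg k : 'rV[R]_n := (gamma k)^-1 *:
  ((x (k%:Z - 1) - gamma k *: uk F x rho alpha k) - xn k).

(** The pairing of consecutive increments of [F], together with the multiples of [[cos phi_k]_-]
    that [B] and [C] set aside to compensate a negative cosine. *)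
Definition cross k :=
  2 * gamma k.+1 ^+ 2 * (1 + alpha * rho k.+1) * (alpha * rho k) *
    dotp (f k) (f1 k) +
  negpart (cosphi F x k) *
    (mu * (gamma k.+1 * (1 + alpha * rho k.+1)) ^+ 2 * dotp (f k) (f k) +
     (gamma k.+1 * (alpha * rho k)) ^+ 2 / mu * dotp (f1 k) (f1 k)).

Definition loss k := gamma k.+1 ^+ 2 * dotp (sg k.+1 - sg k) (sg k.+1 - sg k) +
  (C k * dotp (d k) (d k) +
   (alpha * (gamma k * rho k)) ^+ 2 * B k * dotp (f1 k) (f1 k) +
   2 * alpha * rho k.+1 ^+ 3 * gamma k * dotp (d k) (f k) + cross k).

Lemma subSZ1 k : k.+1%:Z - 1 = k%:Z.
Proof. by rewrite intS addrC addKr. Qed.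

Lemma f1S k : f1 k.+1 = f k.
Proof. by rewrite subSZ1. Qed.

Lemma alpha_gt0 : 0 < alpha.
Proof. exact: lt_le_trans alpha_ge1. Qed.

Lemma rho_gt0 k : 0 < rho k.
Proof. by case: k => // k; rewrite rhoE divr_gt0. Qed.

Lemma gammaS k : gamma k.+1 = rho k.+1 * gamma k.
Proof. by rewrite rhoE divfK// gt_eqF. Qed.

Lemma scale_sg k : gamma k *: sg k =
  - d k - gamma k *: F (x (k%:Z - 1)) - (gamma k * (alpha * rho k)) *: f1 k.
Proof.
rewrite /sg scalerA mulfV ?gt_eqF// scale1r /uk /dx /dF.
have -> : k%:Z - 1 - 1 = k%:Z - 2 by rewrite -addrA -opprD.
by apply/rowP => i; rewrite !mxE; ring.
Qed.

Lemma step_subgradient k : prox_step F g x gamma rho alpha k ->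
  subdifferential g (xn k) (sg k).
Proof. by move=> /prox_subgradient; exact. Qed.

Lemma sg_mono k : prox_step F g x gamma rho alpha k ->
  0 <= dotp (sg k.+1 - sg k) (d k.+1).
Proof.
move=> xk; have p1 := step_subgradient k xk.
have p2 := step_subgradient k.+1 (x_step k).
have := subgradient_fine g_proper p1 (subgradient_edom g_proper p2).
have := subgradient_fine g_proper p2 (subgradient_edom g_proper p1).
have -> : xn k - xn k.+1 = - d k.+1 by rewrite /dx subSZ1 opprB.
have -> : xn k.+1 - xn k = d k.+1 by rewrite /dx subSZ1.
by rewrite !dotpE; lra.
Qed.

Lemma mono_dF j : 0 <= dotp (dx x j) (dF F x j).
Proof. by rewrite dotpC; exact: F_mono. Qed.

(** The expression is the denominator of [tau] multiplied by [gamma k * rho k]. *)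
Lemma tau_den_gt0 k : d k != 0 \/ f1 k != 0 ->
  0 < eps / 2 * dotp (d k) (d k) + (rho k * gamma k) ^+ 2 / (2 * eps) *
      dotp (f1 k) (f1 k).
Proof.
have pos (v : 'rV[R]_n) : v != 0 -> 0 < dotp v v.
  move=> v0; rewrite -sqr_enorm exprn_gt0// lt_def enorm_ge0 andbT.
  by apply: contra v0 => /eqP/enorm_eq0 ->.
have c1 : 0 < eps / 2 by rewrite divr_gt0.
have c2 : 0 < (rho k * gamma k) ^+ 2 / (2 * eps).
  by rewrite divr_gt0 ?(mulr_gt0 _ eps_gt0)// exprn_gt0// mulr_gt0// rho_gt0.
case=> /pos h; [apply: ltr_pwDl|apply: ltr_pwDr].
- exact: mulr_gt0.
- by apply: mulr_ge0; rewrite ?dotp_ge0// ltW.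
- exact: mulr_gt0.
- by apply: mulr_ge0; rewrite ?dotp_ge0// ltW.
Qed.

(** Like the next three identities, a form without quotients that survives a zero denominator: the
    numerator then vanishes too, in agreement with [t / 0 = 0]. *)
Lemma tau_spec k : tau F x gamma rho eps k *
  (eps / 2 * dotp (d k) (d k) +
   (rho k * gamma k) ^+ 2 / (2 * eps) * dotp (f1 k) (f1 k)) =
  gamma k * rho k * dotp (d k) (f1 k).
Proof.
rewrite /tau; have [dk|df] := boolP ((d k == 0) && (f1 k == 0)).
  by case/andP: dk => /eqP -> /eqP ->; rewrite !dotp0r !mulr0 addr0 !mulr0.
have {}den : 0 < eps / 2 * dotp (d k) (d k) + (rho k * gamma k) ^+ 2 / (2 * eps) *
      dotp (f1 k) (f1 k).
  by apply: tau_den_gt0; move: df; rewrite negb_and => /orP.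
have rg : rho k * gamma k != 0 by rewrite gt_eqF// mulr_gt0// rho_gt0.
rewrite !sqr_enorm.
set D := (X in _ / X); set E := (X in _ * X = _).
have DE : D = E / (gamma k * rho k).
  rewrite /D /E; move: rg; rewrite mulf_eq0 negb_or => /andP[r0 g0].
  by field; rewrite r0 g0 gt_eqF.
have E0 : E != 0 by rewrite gt_eqF.
rewrite {}DE; move: E E0 => E E0.
by rewrite invf_div mulrA divfK// mulrC.
Qed.

Lemma L_spec k : L_ F x k ^+ 2 * dotp (d k) (d k) = dotp (f k) (f k).
Proof.
rewrite /L_ -!sqr_enorm -exprMn.
have [d0|d0] := eqVneq (enorm (d k)) 0; last by rewrite divfK.
have : f k = 0.
  by have /subr0_eq := enorm_eq0 _ d0; rewrite /dF => ->; rewrite subrr.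
by rewrite d0 mulr0 => ->; rewrite enorm0.
Qed.

Lemma ell_spec k : ell_ F x k * dotp (d k) (d k) = dotp (d k) (f k).
Proof.
rewrite /ell_ -!sqr_enorm dotpC.
have [d0|d0] := eqVneq (enorm (d k)) 0; last by rewrite divfK// sqrf_eq0.
by rewrite d0 expr0n mulr0 (enorm_eq0 _ d0) dotpC dotp0r.
Qed.

Lemma cos_spec k :
  dotp (f k) (f1 k) = cosphi F x k * (enorm (f k) * enorm (f1 k)).
Proof.
rewrite /cosphi.
have [/eqP|h] := eqVneq (enorm (f k) * enorm (f1 k)) 0; last by rewrite divfK.
rewrite mulf_eq0 => /orP[]/eqP/enorm_eq0 ->.
  by rewrite enorm0 mul0r mulr0 dotpC dotp0r.
by rewrite enorm0 !mulr0 dotp0r.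
Qed.

Lemma cross_ge0 k : 0 <= cross k.
Proof.
have P0 : 0 <= gamma k.+1 * (1 + alpha * rho k.+1).
  by rewrite mulr_ge0 ?addr_ge0 ?mulr_ge0 ?ltW// ?alpha_gt0 ?rho_gt0.
have Q0 : 0 <= gamma k.+1 * (alpha * rho k).
  by rewrite mulr_ge0 ?mulr_ge0 ?ltW// ?alpha_gt0 ?rho_gt0.
apply: (le_trans (cross_term_ge0 _ _ _ _ _ _ P0 Q0 mu_gt0 (cos_spec k))).
by rewrite /cross lerD2r le_eqVlt; apply/orP; left; apply/eqP; ring.
Qed.

(** The one-step bound at [e = x^k - z], its slack rewritten as [loss k]. Both conditions on [k], a
    prox step at [k] and a finite [g (x^{k-1})], hold from [k = 2] on. *)
Lemma descent k z : prox_step F g x gamma rho alpha k -> edom g z ->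
  edom g (x (k%:Z - 1)) ->
  Ur k.+1 z + alpha * gamma k * A k * Vr (k%:Z - 1) z + loss k <= Ur k z.
Proof.
move=> xk gz gx1; have p1 := step_subgradient k xk.
have p2 := step_subgradient k.+1 (x_step k).
have gx := subgradient_edom g_proper p1.
have gx2 := subgradient_edom g_proper p2.
pose e := xn k - z.
pose w := rho k.+1 *: d k - (gamma k.+1 * (1 + alpha * rho k.+1)) *: f k +
  (gamma k.+1 * alpha * rho k) *: f1 k.
have FE : F (x (k%:Z - 1)) + f k = F (xn k) by rewrite /dF addrC subrK.
have := @one_step_bound R n e (d k) (d k.+1) (f k) (f1 k) (F (x (k%:Z - 1)))
  (sg k) (sg k.+1) w alpha lambda (gamma k) (rho k) (gamma k.+1) (rho k.+1)
  (fine (g (xn k.+1))) (fine (g (xn k))) (fine (g (x (k%:Z - 1)))) (fine (g z))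
  (Vr (k%:Z) z) (Vr (k%:Z - 1) z).
move/(_ alpha_gt0 (gamma_gt0 k) (gamma_gt0 k.+1) (gammaS k)).
have rh : 0 <= alpha * rho k.+1 * gamma k.+1.
  by rewrite !mulr_ge0// ltW// ?alpha_gt0 ?rho_gt0.
move/(_ rh (scale_sg k)).
have e2 : e + d k.+1 = xn k.+1 - z.
  by rewrite /e /dx subSZ1 addrC addrA subrK.
have e1 : d k - e = z - x (k%:Z - 1).
  by rewrite /e /dx; apply/rowP => i; rewrite !mxE; ring.
rewrite FE e1 -{1}f1S -{1}(subSZ1 k) => /(_ (scale_sg k.+1) erefl erefl).
have -> : - e = z - xn k by rewrite /e opprB.
move=> /(_ erefl); rewrite e2.
have -> : - (xn k.+1 - z) = z - xn k.+1 by rewrite opprB.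
move=> /(_ (subgradient_fine g_proper p2 gz)).
have -> : d k.+1 = xn k.+1 - xn k by rewrite /dx subSZ1.
move=> /(_ (subgradient_fine g_proper p1 gx2)).
have -> : - d k = x (k%:Z - 1) - xn k by rewrite /dx opprB.
move=> /(_ (subgradient_fine g_proper p1 gx1)).
have := sg_mono k xk.
have {1}-> : d k.+1 = xn k.+1 - xn k by rewrite /dx subSZ1.
move=> mon /(_ mon).
rewrite (@coefficients_identity R n (d k) (f k) (f1 k) w alpha eps mu lambda
  (gamma k) (rho k) (gamma k.+1) (rho k.+1) (L_ F x k) (ell_ F x k)
  (tau F x gamma rho eps k) (negpart (cosphi F x k)) alpha_gt0 eps_gt0 mu_gt0
  (gammaS k) erefl (L_spec k) (ell_spec k) (tau_spec k)).
rewrite /Ur /loss subSZ1 !sqr_enorm -/e /cross /Acoef /Bcoef /Ccoef.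
have -> : d k.+1 = xn k.+1 - xn k by rewrite /dx subSZ1.
by rewrite -!addrA.
Qed.

Local Ltac nonneg := repeat first [ done | apply: sqr_ge0 | apply: exprn_ge0
  | apply: mulr_ge0 | apply: addr_ge0 | apply: dotp_ge0 | apply: enorm_ge0
  | rewrite invr_ge0 | exact: ltW alpha_gt0 | exact: ltW (rho_gt0 _)
  | exact: ltW (gamma_gt0 _) | exact: ltW | apply: mono_dF | apply: C_ge0
  | apply: B_ge0 | apply: A_ge0 ].

Lemma edomS k : edom g (xn k.+1).
Proof.
exact: (subgradient_edom g_proper (step_subgradient k.+1 (x_step k))).
Qed.

Lemma edomSB k : edom g (x (k.+2%:Z - 1)).
Proof. by rewrite subSZ1; exact: edomS. Qed.

Lemma Vk_fin j z : edom g (x j) -> edom g z -> Vk F g x j z = (Vr j z)%:E.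
Proof.
by move=> gj gz; rewrite /Vk /Vr !EFinB !(edom_fineK g_proper).
Qed.

Lemma Vk_infty j z : ~ edom g (x j) -> edom g z -> Vk F g x j z = +oo%E.
Proof.
move=> gj gz; rewrite /Vk -(edom_fineK g_proper gz).
have -> : g (x j) = +oo%E by apply/eqP; rewrite -leye_eq leNgt; apply/negP.
by rewrite !addye.
Qed.

Lemma Uk_fin k z : edom g (x (k%:Z - 1)) -> edom g z ->
  Uk F g x gamma rho alpha lambda k z = (Ur k z)%:E.
Proof. by move=> gk gz; rewrite /Uk (Vk_fin _ _ gk gz) -EFinM -EFinD. Qed.

Lemma weight_gt0 k : 0 < (1 + alpha * rho k) * gamma k.
Proof. by rewrite mulr_gt0// addr_gt0// mulr_gt0 ?alpha_gt0 ?rho_gt0. Qed.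

Lemma Uk_infty k z : ~ edom g (x (k%:Z - 1)) -> edom g z ->
  Uk F g x gamma rho alpha lambda k z = +oo%E.
Proof.
move=> gk gz; rewrite /Uk (Vk_infty _ _ gk gz).
by rewrite gt0_muley ?lte_fin ?weight_gt0// addey.
Qed.

Lemma zerT_subgradient z : zerT F g z -> subdifferential g z (- F z).
Proof. by case=> v zv /eqP; rewrite addrC addr_eq0 => /eqP <-. Qed.

Lemma zerT_edom z : zerT F g z -> edom g z.
Proof. by move/zerT_subgradient/(subgradient_edom g_proper). Qed.

(** Monotonicity moves the evaluation of [F] from [x^j] to [z]. The left side is then convex in
    [x^j], as needed for averaging and for Minty's lemma. *)
Lemma Vr_mono j z : fine (g (x j)) - fine (g z) + dotp (F z) (x j - z) <= Vr j z.
Proof.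
by have := F_mono (x j) z; rewrite /Vr !dotpE; lra.
Qed.

Lemma Vr_ge0 j z : zerT F g z -> edom g (x j) -> 0 <= Vr j z.
Proof.
move=> zz gj; apply: le_trans (Vr_mono j z).
have := subgradient_fine g_proper (zerT_subgradient z zz) gj.
by rewrite dotpNl; lra.
Qed.

Lemma Vk_ge0 j z : zerT F g z -> (0 <= Vk F g x j z)%E.
Proof.
move=> zz; have gz := zerT_edom z zz; have [gj|gj] := pselect (edom g (x j)).
  by rewrite Vk_fin// lee_fin Vr_ge0.
by rewrite Vk_infty// leey.
Qed.

Lemma dist_le_Ur k z :
  2^-1 * enorm (xn k - z) ^+ 2 + (1 + alpha * rho k) * gamma k * Vr (k%:Z - 1) z
  <= Ur k z.
Proof.
by rewrite /Ur lerD2r -addrA lerDl; nonneg.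
Qed.

Lemma Vr_le_Ur k z : (1 + alpha * rho k) * gamma k * Vr (k%:Z - 1) z <= Ur k z.
Proof.
by apply: le_trans (dist_le_Ur k z); rewrite lerDr; nonneg.
Qed.

Lemma Ur_ge0 k z : zerT F g z -> edom g (x (k%:Z - 1)) -> 0 <= Ur k z.
Proof.
move=> zz gk; apply: le_trans (Vr_le_Ur k z).
by rewrite mulr_ge0 ?Vr_ge0// ltW// weight_gt0.
Qed.

Lemma Uk_ge0 k z : zerT F g z ->
  (0 <= Uk F g x gamma rho alpha lambda k z)%E.
Proof.
move=> zz; have gz := zerT_edom z zz.
have [gj|gj] := pselect (edom g (x (k%:Z - 1))).
  by rewrite Uk_fin// lee_fin Ur_ge0.
by rewrite Uk_infty// leey.
Qed.

(** * Telescoping the descent: boundedness and the rate of the smallest gap *)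

Lemma gapterm_ge0 k : 0 <= alpha * gamma k * A k.
Proof. by nonneg. Qed.

(** Every summand of [loss] is nonnegative, so the sum dominates each of them. The last bound drops
    the nonnegative compensation from [cross]. *)
Lemma loss_parts k : [/\ 0 <= loss k,
  gamma k.+1 ^+ 2 * dotp (sg k.+1 - sg k) (sg k.+1 - sg k) <= loss k,
  C k * dotp (d k) (d k) <= loss k,
  2 * alpha * rho k.+1 ^+ 3 * gamma k * dotp (d k) (f k) <= loss k &
  2 * gamma k.+1 ^+ 2 * (1 + alpha * rho k.+1) * (alpha * rho k) *
    dotp (f k) (f1 k) <= loss k].
Proof.
have h1 : 0 <= gamma k.+1 ^+ 2 * dotp (sg k.+1 - sg k) (sg k.+1 - sg k).
  by nonneg.
have h2 : 0 <= C k * dotp (d k) (d k) by nonneg.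
have h3 : 0 <= (alpha * (gamma k * rho k)) ^+ 2 * B k * dotp (f1 k) (f1 k).
  by nonneg.
have h4 : 0 <= 2 * alpha * rho k.+1 ^+ 3 * gamma k * dotp (d k) (f k).
  by nonneg.
have h5 := cross_ge0 k.
have h6 : 2 * gamma k.+1 ^+ 2 * (1 + alpha * rho k.+1) * (alpha * rho k) *
    dotp (f k) (f1 k) <= cross k.
  rewrite /cross lerDl mulr_ge0//; first by rewrite /negpart le_max lexx orbT.
  by nonneg.
by rewrite /loss; split; lra.
Qed.

Lemma Uk_descent k z : prox_step F g x gamma rho alpha k -> zerT F g z ->
  (Uk F g x gamma rho alpha lambda k.+1 z <=
   Uk F g x gamma rho alpha lambda k z)%E.
Proof.
move=> xk zz; have gz := zerT_edom z zz.
have [gj|gj] := pselect (edom g (x (k%:Z - 1))); last first.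
  by rewrite (Uk_infty k)// leey.
rewrite !Uk_fin//; last first.
  by rewrite subSZ1; exact: (subgradient_edom g_proper (step_subgradient k xk)).
rewrite lee_fin; apply: le_trans (descent k z xk gz gj).
rewrite -addrA lerDl addr_ge0//; first by rewrite mulr_ge0 ?gapterm_ge0 ?Vr_ge0.
by have [] := loss_parts k.
Qed.

(** Indices start at 1, where prox steps are available. Finiteness of [g (x^{m-1})] is assumed for
    the sake of [m = 1], as [x^0] may lie outside the domain. *)
Lemma telescope m N z : (0 < m <= N)%N -> edom g z -> edom g (x (m%:Z - 1)) ->
  Ur N z + \sum_(m <= k < N) alpha * gamma k * A k * Vr (k%:Z - 1) z <= Ur m z.
Proof.
move=> /andP[m0 mN] gz gm; elim: N mN => [|N ih].
  by rewrite leqn0 => /eqP m00; rewrite m00 in m0.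
rewrite leq_eqVlt => /predU1P[<-|]; first by rewrite big_geq// addr0.
rewrite ltnS => mN; apply: le_trans (ih mN).
rewrite big_nat_recr//=.
have gN : edom g (x (N%:Z - 1)).
  move: mN; case: N {ih} => [|[|N]] mN; last exact: edomSB.
    by move: m0; rewrite ltnNge mN.
  have m1 : m = 1%N by apply/eqP; rewrite eqn_leq mN m0.
  by move: gm; rewrite m1.
have xN : prox_step F g x gamma rho alpha N.
  move: mN; case: N {ih gN} => [|N] mN; last exact: x_step.
  by move: m0; rewrite ltnNge mN.
have [l0 _ _ _ _] := loss_parts N.
have := descent N z xN gz gN; lra.
Qed.

(** By [gamma_{k+1} = rho_{k+1} gamma_k], each term is [gamma_k + alpha (rho_k gamma_k - rho_{k+1}
    gamma_{k+1})], and the second part telescopes. *)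
Lemma sum_weights m N : (m <= N)%N ->
  \sum_(m <= k < N) alpha * gamma k * A k + (1 + alpha * rho N) * gamma N =
  \sum_(m <= k < N.+1) gamma k + alpha * rho m * gamma m.
Proof.
elim: N => [|N ih].
  by rewrite leqn0 => /eqP ->; rewrite big_geq// big_nat1; ring.
rewrite leq_eqVlt => /predU1P[->|]; first by rewrite big_geq// big_nat1; ring.
rewrite ltnS => mN; rewrite big_nat_recr//= [in RHS]big_nat_recr ?leqW//=.
rewrite [RHS]addrAC -ih// -!addrA; congr (_ + _).
rewrite /Acoef gammaS; field; rewrite ?gt_eqF ?alpha_gt0//.
Qed.

(** Put [c] in place of every gap in the telescoped inequality, including the one inside [Ur N z];
    the total weight is at least the sum of the step sizes. *)
Lemma min_gap m N z c : (0 < m <= N)%N -> zerT F g z ->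
  edom g (x (m%:Z - 1)) -> 0 <= c ->
  (forall k, (m <= k <= N)%N -> c <= Vr (k%:Z - 1) z) ->
  c * \sum_(m <= k < N.+1) gamma k <= Ur m z.
Proof.
move=> mN0 zz gm c0 cV; have /andP[m0 mN] := mN0.
apply: le_trans (telescope m N z mN0 (zerT_edom z zz) gm).
apply: le_trans (lerD (Vr_le_Ur N z) (lexx _)).
apply: (@le_trans _ _ (c * (\sum_(m <= k < N.+1) gamma k + alpha * rho m * gamma m))).
  by rewrite ler_wpM2l// lerDl; nonneg.
rewrite -(sum_weights m N mN) mulrDr addrC lerD//.
  by rewrite mulrC ler_wpM2l ?cV ?mN ?leqnn// ltW// weight_gt0.
rewrite mulr_sumr; apply: ler_sum_nat => k /andP[mk kN].
by rewrite mulrC ler_wpM2l ?gapterm_ge0// cV// mk ltnW.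
Qed.

Lemma Ur_noninc m N z : (0 < m <= N)%N -> zerT F g z ->
  edom g (x (m%:Z - 1)) -> Ur N z <= Ur m z.
Proof.
move=> mN zz gm; have gz := zerT_edom z zz.
apply: le_trans (telescope m N z mN gz gm); rewrite lerDl.
rewrite big_seq_cond; apply: sumr_ge0 => k /andP[].
rewrite mem_index_iota => /andP[mk kN] _; case/andP: mN => m0 mN.
rewrite mulr_ge0 ?gapterm_ge0// Vr_ge0//.
move: mk; rewrite leq_eqVlt => /predU1P[<-//|].
by case: k kN => [|[|k]] _ mk; [|move: m0; rewrite leqNgt mk|exact: edomSB].
Qed.

(** From index 2 on [U] is certainly finite, since it involves [g (x^1)], and [U_2] controls the
    distances. The first two iterates are added to the bound by hand. *)
Lemma iterates_bounded z : zerT F g z -> exists M, forall k, enorm (xn k - z) <= M.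
Proof.
move=> zz; have U0 : 0 <= 2 * Ur 2 z.
  by rewrite mulr_ge0// Ur_ge0//; exact: edomSB.
exists (Num.sqrt (2 * Ur 2 z) + (enorm (xn 0 - z) + enorm (xn 1 - z))).
have e0 := enorm_ge0 (xn 0 - z); have e1 := enorm_ge0 (xn 1 - z).
have s0 := sqrtr_ge0 (2 * Ur 2 z).
case=> [|[|k]]; [lra|lra|]; apply: (@le_trans _ _ (Num.sqrt (2 * Ur 2 z))).
  rewrite -(ger0_norm (enorm_ge0 _)) -sqrtr_sqr ler_wsqrtr//.
  rewrite -ler_pdivrMl//; apply: le_trans (Ur_noninc 2 k.+2 z isT zz (edomSB 0)).
  apply: le_trans (dist_le_Ur k.+2 z); rewrite lerDl mulr_ge0//.
    by rewrite ltW ?weight_gt0.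
  by rewrite Vr_ge0//; exact: edomSB.
by rewrite lerDl addr_ge0.
Qed.

Lemma minV_bound K z : zerT F g z -> (minV F g x K z <=
  Uk F g x gamma rho alpha lambda 1 z * ((\sum_(1 <= k < K.+2) gamma k)^-1)%:E)%E.
Proof.
move=> zz; have gz := zerT_edom z zz.
have S0 : 0 < \sum_(1 <= k < K.+2) gamma k.
  by rewrite big_nat_recl//= ltr_wpDr// sumr_ge0// => k _; exact: ltW.
(* If [g (x^0) = +oo] then [U_1 = +oo] and the bound is trivial. Otherwise the minimum is a real
   [c], to which [min_gap] applies with [m = 1] and [N = K + 1]. *)
have [g0|g0] := pselect (edom g (x (1%:Z - 1))); last first.
  by rewrite Uk_infty// gt0_mulye ?leey// lte_fin invr_gt0.
rewrite Uk_fin// lee_pdivlMr//.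
have mV k : (k <= K)%N -> (minV F g x K z <= (Vr k z)%:E)%E.
  move=> kK; have gk : edom g (xn k) by case: k {kK} => [|k] //; exact: edomS.
  rewrite -(Vk_fin _ _ gk gz) /minV.
  exact: (bigmin_le _ (Ordinal (kK : (k < K.+1)%N))
    (fun i : 'I_K.+1 => Vk F g x (i : nat)%:Z z)).
have m0 : (0 <= minV F g x K z)%E by apply: le_bigmin => // i _; exact: Vk_ge0.
have mfin : minV F g x K z \is a fin_num.
  by rewrite ge0_fin_numE// (le_lt_trans (mV 0%N _))// ltry.
move: m0 mV; rewrite -(fineK mfin) lee_fin; set c := fine _ => c0 mV.
rewrite -EFinM lee_fin.
apply: min_gap => // k; case: k => // k kK.
by rewrite subSZ1 -lee_fin mV.
Qed.

(** * Divergent step sizes and the ergodic sequence *)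

Lemma steps_diverge : (\sum_(0 <= k <oo) (gamma k)%:E = +oo)%E ->
  forall b m, exists2 N, (m <= N)%N & b < \sum_(m <= k < N) gamma k.
Proof.
move=> goo b m; apply: contrapT => hN.
have {}hN N : (m <= N)%N -> \sum_(m <= k < N) gamma k <= b.
  by move=> mN; rewrite leNgt; apply/negP => h; apply: hN; exists N.
suff : (\sum_(0 <= k <oo) (gamma k)%:E <= (\sum_(0 <= k < m) gamma k + `|b|)%:E)%E.
  by rewrite goo leye_eq.
apply: lime_le.
  by apply: is_cvg_nneseries => k _ _; rewrite lee_fin ltW.
apply: nearW => N; rewrite sumEFin lee_fin.
have [mN|/ltnW Nm] := leqP m N.
  by rewrite (big_cat_nat (leq0n m) mN)//= lerD2l (le_trans (hN N mN))// ler_norm.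
rewrite [in leRHS](big_cat_nat (leq0n N) Nm)//= -addrA lerDl addr_ge0//.
by apply: sumr_ge0 => k _; exact: ltW.
Qed.

(** If the gap stayed above [e] from some index on, [min_gap] would bound the partial sums of
    [gamma]. *)
Lemma small_gap z : (\sum_(0 <= k <oo) (gamma k)%:E = +oo)%E -> zerT F g z ->
  forall e m, 0 < e -> exists2 k, (m <= k)%N & (Vk F g x k%:Z z <= e%:E)%E.
Proof.
move=> goo zz e m e0; apply: contrapT => hk; have gz := zerT_edom z zz.
have {}hk k : (m < k)%N -> e <= Vr k z.
  case: k => // k mk; rewrite leNgt; apply/negP => h; apply: hk.
  by exists k.+1; [exact: ltnW|rewrite (Vk_fin _ _ (edomS k))// lee_fin ltW].
have [N mN bN] := steps_diverge goo (Ur m.+2 z / e) m.+2.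
have mN1 : (0 < m.+2 <= N)%N by [].
have := min_gap m.+2 N z e mN1 zz (edomSB m) (ltW e0).
apply/not_implyP; split.
  by case=> // k /andP[mk kN]; rewrite subSZ1; exact: hk.
apply/negP; rewrite -ltNge mulrC -ltr_pdivrMr//; apply: (lt_le_trans bN).
by rewrite big_nat_recr//= lerDl ltW.
Qed.

Lemma liminf_gap z : (\sum_(0 <= k <oo) (gamma k)%:E = +oo)%E -> zerT F g z ->
  limn_einf (fun k : nat => Vk F g x k%:Z z) = 0%E.
Proof.
move=> goo zz; rewrite limn_einf_lim.
suff -> : einfs (fun k : nat => Vk F g x k%:Z z) = cst 0%E by rewrite lim_cst.
apply/funext => m /=; apply/eqP; rewrite eq_le; apply/andP; split.
  apply/lee_addgt0Pr => e e0; rewrite add0e.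
  have [k mk Vk_e] := small_gap z goo zz e m e0.
  by apply: le_trans Vk_e; apply: ereal_inf_lbound; exists k.
by apply: le_ereal_inf_tmp => _ [k _ <-]; exact: Vk_ge0.
Qed.

Lemma ergodic_weight_gt0 K :
  0 < \sum_(2 <= k < K.+1) alpha * gamma k * A k +
    (1 + alpha * rho K.+1) * gamma K.+1.
Proof.
rewrite ltr_wpDl ?weight_gt0//; apply: sumr_ge0 => k _; exact: gapterm_ge0.
Qed.

(** Jensen's inequality for the weights of [xbar], then the descent telescoped from 2 to [K + 1].
    For a [z] that is no solution [Ur 2 z] may be negative; the maximum with 0 allows the total
    weight [W] to be replaced by the smaller [S]. *)
Lemma xbar_gap K z : (1 <= K)%N -> edom g z ->
  (g (xbar x gamma rho alpha K) +
    (dotp (F z) (xbar x gamma rho alpha K - z))%:E <=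
   g z + (Num.max (Ur 2 z) 0 / \sum_(1 <= k < K.+1) gamma k.+1)%:E)%E.
Proof.
case: K => // K _ gz; set S := \sum_(_ <= _ < _) _.
have := ergodic_weight_gt0 K.+1; rewrite /xbar.
set W := _ + _ => W0; set Y : 'rV[R]_n := _ + _ *: xn K.+1.
have SE : S = \sum_(2 <= k < K.+3) gamma k by rewrite [RHS]big_add1.
have S0 : 0 < S.
  rewrite /S big_nat_recl//= ltr_wpDr//.
  by apply: sumr_ge0 => k _; exact: ltW.
have SW : S <= W.
  by rewrite /W sum_weights// SE lerDl; nonneg.
pose H := \sum_(2 <= k < K.+2) alpha * gamma k * A k * fine (g (x (k%:Z - 1))) +
  (1 + alpha * rho K.+2) * gamma K.+2 * fine (g (xn K.+1)).
have [|[_ gY]] : wmean (g := g) W Y H.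
- rewrite /W /Y /H; apply: wmean_add => //; last 2 first.
  + by apply/ltW/weight_gt0.
  + exact: edomS.
  apply: (wmean_sum g_proper g_convex _ _ (fun k => x (k%:Z - 1))) => k.
  rewrite mem_index_iota => /andP[k2 _]; split; first exact: gapterm_ge0.
  by case: k k2 => [|[|k]] // _; exact: edomSB.
- by case=> W00; move: W0; rewrite W00 ltxx.
have gYd := edom_EFin gY.
move: gY; rewrite -(edom_fineK g_proper gYd) -(edom_fineK g_proper gz).
rewrite -!EFinD !lee_fin.
set gY := fine (g _) => gYH.
(* The left side is the weighted sum of the lower bounds of [Vr_mono], hence at most the weighted
   sum of gaps in [telescope]. *)
have key : H - W * fine (g z) + dotp (F z) (Y - W *: z) <= Ur 2 z.
  have := telescope 2 K.+2 z isT gz (edomSB 0).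
  apply: le_trans; apply: (le_trans _ (lerD (Vr_le_Ur K.+2 z) (lexx _))).
  rewrite subSZ1 [leRHS]addrC.
  pose v j := fine (g (x j)) - fine (g z) + dotp (F z) (x j - z).
  apply: (@le_trans _ _ (\sum_(2 <= k < K.+2) alpha * gamma k * A k *
      v (k%:Z - 1) + (1 + alpha * rho K.+2) * gamma K.+2 * v K.+1%:Z)).
    rewrite /H /Y /W dotpDr dotpNr dotpZr dotpDr dotpZr (dotpC (F z) (\sum_(_ <- _) _)).
    rewrite dotp_suml le_eqVlt; apply/orP; left; apply/eqP.
    have -> : \sum_(2 <= k < K.+2) alpha * gamma k * A k * v (k%:Z - 1) =
      \sum_(2 <= k < K.+2) (alpha * gamma k * A k * fine (g (x (k%:Z - 1)))) +
      \sum_(2 <= k < K.+2) (dotp ((alpha * gamma k * A k) *: x (k%:Z - 1)) (F z)) -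
      (\sum_(2 <= k < K.+2) alpha * gamma k * A k) * (fine (g z) + dotp (F z) z).
      rewrite mulr_suml -big_split -sumrB; apply: eq_bigr => k _.
      by rewrite /v dotpZl (dotpC _ (F z)) dotpDr dotpNr /=; ring.
    by rewrite /v dotpDr dotpNr; ring.
  apply: lerD; last by rewrite ler_pM2l ?weight_gt0// Vr_mono.
  by apply: ler_sum => k _; rewrite ler_wpM2l ?gapterm_ge0// Vr_mono.
have -> : W^-1 *: Y - z = W^-1 *: (Y - W *: z).
  by rewrite scalerBr scalerA mulVf ?scale1r// gt_eqF.
rewrite dotpZr -lerBlDl.
apply: (@le_trans _ _ (W^-1 * Ur 2 z)).
  apply: le_trans (ler_wpM2l (_ : 0 <= W^-1) key); last by rewrite invr_ge0 ltW.
  rewrite mulrDr mulrBr mulrA mulVf ?gt_eqF// mul1r; move: gYH.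
  by set X := W^-1 * dotp _ _; lra.
rewrite mulrC; apply: (@le_trans _ _ (Num.max (Ur 2 z) 0 / W)).
  by rewrite ler_pM2r ?invr_gt0// le_max lexx.
by rewrite ler_wpM2l ?le_max ?lexx ?orbT// lef_pV2 ?posrE.
Qed.

Lemma bounded_fun_enorm (q : nat -> 'rV[R]_n) M : (forall k, enorm (q k) <= M) ->
  bounded_fun q.
Proof.
move=> qM; rewrite /= /bounded_near; near=> r => k _ /=.
apply: le_trans (norm_le_enorm _) _; apply: le_trans (qM k) _.
by near: r; apply: nbhs_pinfty_ge; exact: num_real.
Unshelve. all: by end_near. Qed.

Lemma xn_bounded z : zerT F g z -> exists M, forall k, enorm (xn k) <= M.
Proof.
move=> /iterates_bounded[M xM]; exists (M + enorm z) => k.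
by rewrite -(subrK z (xn k)) (le_trans (enormD _ _))// lerD2r.
Qed.

Lemma enorm_wsum_le (s : seq nat) (w : nat -> R) (q : nat -> 'rV[R]_n) M :
  (forall i, i \in s -> 0 <= w i /\ enorm (q i) <= M) ->
  enorm (\sum_(i <- s) w i *: q i) <= (\sum_(i <- s) w i) * M.
Proof.
elim: s => [_|i s ih h]; first by rewrite !big_nil mul0r enorm0.
have [wi qi] := h i (mem_head _ _).
rewrite !big_cons mulrDl (le_trans (enormD _ _))// lerD//.
  by rewrite enormZ ger0_norm// ler_wpM2l.
by apply: ih => j js; apply: h; rewrite in_cons js orbT.
Qed.

Lemma xbar_bounded z : zerT F g z -> bounded_fun (xbar x gamma rho alpha).
Proof.
move=> /xn_bounded[M xM]; apply: (bounded_fun_enorm _ M) => K.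
have W0 := ergodic_weight_gt0 K.
rewrite /xbar enormZ gtr0_norm ?invr_gt0// [leLHS]mulrC ler_pdivrMr// [leRHS]mulrC.
rewrite (le_trans (enormD _ _))// [leRHS]mulrDl lerD//; last first.
  by rewrite enormZ gtr0_norm ?weight_gt0// ler_pM2l ?weight_gt0.
apply: (enorm_wsum_le _ _ (fun k => x (k%:Z - 1))) => k.
rewrite mem_index_iota => /andP[k2 _]; split; first exact: gapterm_ge0.
by case: k k2 => // k _; rewrite subSZ1.
Qed.

Lemma inv_steps_cvg0 b : (\sum_(0 <= k <oo) (gamma k)%:E = +oo)%E ->
  (fun K => b / \sum_(1 <= k < K.+1) gamma k.+1) @ \oo --> 0.
Proof.
move=> goo; apply/cvgrPdist_lt => e e0.
have [N _ bN] := steps_diverge goo (`|b| / e) 2.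
near=> K; rewrite sub0r normrN normrM.
have SN : `|b| / e < \sum_(1 <= k < K.+1) gamma k.+1.
  apply: (lt_le_trans bN); have NK : (N <= K)%N by near: K; exact: nbhs_infty_ge.
  have -> : \sum_(1 <= k < K.+1) gamma k.+1 = \sum_(2 <= k < K.+2) gamma k.
    by rewrite [RHS]big_add1.
  have [N2|N2] := leqP N 2.
    by rewrite big_geq// sumr_ge0// => k _; exact: ltW.
  rewrite [leRHS](big_cat_nat (ltnW N2))/=; last by rewrite (leq_trans NK)// ltnW.
  by rewrite lerDl sumr_ge0// => k _; exact: ltW.
have S0 : 0 < \sum_(1 <= k < K.+1) gamma k.+1.
  by apply: le_lt_trans SN; rewrite divr_ge0// ltW.
by rewrite normfV (gtr0_norm S0) ltr_pdivrMr// mulrC -ltr_pdivrMr.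
Unshelve. all: by end_near. Qed.

Lemma xbar_cluster_zerT y : (\sum_(0 <= k <oo) (gamma k)%:E = +oo)%E ->
  cluster (xbar x gamma rho alpha @ \oo) y -> zerT F g y.
Proof.
move=> goo yc; apply: (cluster_zerT _ _ _ _ F_lip g_proper g_convex g_lsc yc).
move=> z gz; exists (fun K => Num.max (Ur 2 z) 0 / \sum_(1 <= k < K.+1) gamma k.+1).
  exact: inv_steps_cvg0.
by near=> K; apply: xbar_gap => //; near: K; exact: nbhs_infty_ge.
Unshelve. all: by end_near. Qed.

Lemma radius_ge0 z : zerT F g z ->
  0 <= sup (range (fun k : nat => enorm (xn k - z))).
Proof.
move=> zz; have [M xM] := iterates_bounded z zz.
apply: le_trans (enorm_ge0 (xn 0 - z)) _; apply: ub_le_sup; last by exists 0%N.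
by exists M => _ [k _ <-].
Qed.

Lemma Gap_bound K z delta : (1 <= K)%N -> zerT F g z -> 0 <= delta ->
  (Gap F g z delta (xbar x gamma rho alpha K) <=
   ereal_sup [set Uk F g x gamma rho alpha lambda 2 y | y in edom g `&` ecball z delta]
   * ((\sum_(1 <= k < K.+1) gamma k.+1)^-1)%:E)%E.
Proof.
move=> K1 zz delta0; set T := ereal_sup _; set S := \sum_(_ <= _ < _) _.
have S0 : 0 < S.
  rewrite /S; case: K K1 @S => // K _ /=; rewrite big_nat_recl//= ltr_wpDr//.
  by apply: sumr_ge0 => k _; exact: ltW.
have gz := zerT_edom z zz.
(* The centre lies in the ball and [U_2] is nonnegative there, so [T] also dominates the 0 of the
   maximum. *)
have T0 : (0 <= T)%E.
  apply: le_trans (Uk_ge0 2 z zz) _; apply: ereal_sup_ubound; exists z => //.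
  by split => //; rewrite /ecball /= subrr enorm0.
apply: ge_ereal_sup => _ [y [gy yd] <-].
have := xbar_gap K y K1 gy; rewrite -/S; set X := xbar _ _ _ _ _ => h.
apply: (@le_trans _ _ (Num.max (Ur 2 y) 0 / S)%:E).
  move: h; rewrite -(edom_fineK g_proper gy) -EFinD => h.
  by rewrite leeBlDr// -EFinD addeC [in leRHS]addrC.
rewrite lee_pdivlMr// -EFinM divfK ?gt_eqF// /Num.max; case: ifPn => // _.
rewrite -Uk_fin//; last exact: edomSB.
by apply: ereal_sup_ubound; exists y.
Qed.

(** * Step sizes bounded below *)

(** [A_{k+1} >= 0] gives [rho_{k+1}^2 <= 1 + rho_k], and [1 + r <= r^2] as soon as [r >= 2]. *)
Lemma rho_bounded : exists2 r, 1 <= r & forall k, rho k <= r.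
Proof.
exists (Num.max (rho 0%N) 2); first by rewrite le_max (ler_nat _ 1 2) orbT.
elim=> [|k ih]; first by rewrite le_max lexx.
set r := Num.max _ _ in ih *; have r2 : 2 <= r by rewrite le_max lexx orbT.
have := A_ge0 k; rewrite /Acoef subr_ge0 => rk.
have ai : alpha^-1 <= 1 by rewrite invf_le1 ?alpha_gt0.
rewrite leNgt; apply/negP => h; have := ltW (rho_gt0 k.+1); nra.
Qed.

(** [Ur] at a solution is nonincreasing and nonnegative, hence convergent, and [loss] is at most its
    decrement. *)
Lemma loss_cvg0 z : zerT F g z -> loss @ \oo --> 0.
Proof.
move=> zz; rewrite -(cvg_shiftn 2).
have uc : cvgn (fun k => Ur (k + 2)%N z).
  apply: nonincreasing_is_cvgn.
    apply/nonincreasing_seqP => k; apply: Ur_noninc => //.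
      by rewrite !addn2 ltnS leqnSn.
    by rewrite addn2; exact: edomSB.
  by exists 0 => _ [k _ <-]; rewrite Ur_ge0// addn2; exact: edomSB.
apply: (cvg0_le _ (fun k => Ur (k + 2)%N z - Ur (k.+1 + 2)%N z)).
  apply: nearW => k /=; have [l0 _ _ _ _] := loss_parts (k + 2).
  rewrite ger0_norm// !addn2.
  have := descent k.+2 z (x_step _) (zerT_edom z zz) (edomSB k).
  have : 0 <= alpha * gamma k.+2 * A k.+2 * Vr (k.+2%:Z - 1) z.
    by rewrite mulr_ge0 ?gapterm_ge0 ?Vr_ge0//; exact: edomSB.
  by lra.
rewrite -(subrr (limn (fun k => Ur (k + 2)%N z))).
apply: cvgB => //; rewrite (cvg_shiftS (fun k => Ur (k + 2)%N z)); exact: uc.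
Qed.

Definition yv k : 'rV[R]_n := (gamma k)^-1 *: d k.
(** The vector [r_k] of the overview, an element of [F (x^k) + subdifferential g (x^k)] whose norm
    measures the failure to solve the inclusion. *)
Definition res k : 'rV[R]_n := sg k + F (xn k).

Lemma yvE k : d k = gamma k *: yv k.
Proof. by rewrite /yv scalerA mulfV ?scale1r// gt_eqF. Qed.

Lemma sg_yv k : sg k = - yv k - F (x (k%:Z - 1)) - (alpha * rho k) *: f1 k.
Proof.
have := scale_sg k; rewrite yvE => /(congr1 ( *:%R (gamma k)^-1)).
rewrite scalerA mulVf ?gt_eqF// scale1r => ->.
by apply/rowP => i; rewrite !mxE; field; rewrite gt_eqF.
Qed.

(** This and the next two identities restate the step through residuals, increments of [F] and the
    increment of [sg], which will be a vanishing perturbation. *)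
Lemma yv_res k :
  yv k.+1 = - (res k + (alpha * rho k.+1) *: f k + (sg k.+1 - sg k)).
Proof.
by rewrite /res (sg_yv k.+1) f1S subSZ1; apply/rowP => i; rewrite !mxE; ring.
Qed.

Lemma res_next k : res k.+1 = res k + f k.+1 + (sg k.+1 - sg k).
Proof.
by rewrite /res /dF subSZ1; apply/rowP => i; rewrite !mxE; ring.
Qed.

Lemma yv_next k : yv k.+1 = yv k + (alpha * rho k) *: f1 k -
  (1 + alpha * rho k.+1) *: f k - (sg k.+1 - sg k).
Proof.
rewrite (sg_yv k.+1) (sg_yv k) f1S subSZ1 /dF.
by apply/rowP => i; rewrite !mxE; ring.
Qed.

Lemma Vr_le_res k z : zerT F g z ->
  Vr k.+1%:Z z <= dotp (res k.+1) (xn k.+1 - z).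
Proof.
move=> zz; have gz := zerT_edom z zz.
have := subgradient_fine g_proper (step_subgradient k.+1 (x_step k)) gz.
by rewrite /Vr /res !dotpE; lra.
Qed.

Lemma cos_ge k : negpart (cosphi F x k) <= 1.
Proof.
rewrite /negpart ge_max ler01 andbT.
have [c0|c0] := leP (- cosphi F x k) 0; first exact: le_trans c0 ler01.
have := dotp_le (- f k) (f1 k); rewrite dotpNl cos_spec enormN -mulNr.
have [/eqP|ff] := eqVneq (enorm (f k) * enorm (f1 k)) 0.
  by move: c0; rewrite /cosphi => /[swap] /eqP ->; rewrite invr0 mulr0 oppr0 ltxx.
by rewrite ger_pMl// lt_def ff mulr_ge0 ?enorm_ge0.
Qed.

Section StepsBoundedBelow.
Context (gmin : R) (z : 'rV[R]_n).
Hypotheses (gmin_gt0 : 0 < gmin) (gmin_le : forall k, gmin <= gamma k).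
Hypothesis zz : zerT F g z.

(** The shift by 2 confines all quantities to [x^0, x^1, ...], on which [F] is bounded. In the bound
    [Z] of the subgradients, the lower bound on [gamma] controls [d / gamma]. *)
Lemma all_bounded : exists2 M, 0 < M & forall k, [/\ enorm (d k.+2) <= M,
  enorm (f k.+2) <= M, enorm (f1 k.+2) <= M & enorm (res k.+2) <= M].
Proof.
have [X xX] := xn_bounded z zz.
have [Y FY] := locally_lipschitz_bounded F X F_lip.
have [r r1 rr] := rho_bounded.
have {}FY k : enorm (F (xn k)) <= Y by exact/FY/xX.
have X0 : 0 <= X by apply: le_trans (xX 0%N); exact: enorm_ge0.
have Y0 : 0 <= Y by apply: le_trans (FY 0%N); exact: enorm_ge0.
have dX k : enorm (d k.+1) <= 2 * X.
  rewrite /dx subSZ1 (le_trans (enormB _ _))// mulr_natl mulr2n lerD//; exact: xX.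
have fY k : enorm (f k.+1) <= 2 * Y.
  by rewrite /dF subSZ1 (le_trans (enormB _ _))// mulr_natl mulr2n lerD.
pose Z := 2 * X / gmin + Y + 2 * r * (2 * Y).
have Z1 : 0 <= 2 * X / gmin by rewrite divr_ge0 ?mulr_ge0// ltW.
have Z2 : 0 <= 2 * r * (2 * Y) by rewrite !mulr_ge0// (le_trans ler01).
exists (2 * X + 2 * Y + (Z + Y) + 1); first by rewrite /Z; lra.
have sgZ k : enorm (sg k.+2) <= Z.
  rewrite sg_yv subSZ1 (le_trans (enormB _ _))// lerD//.
    rewrite (le_trans (enormB _ _))// enormN lerD//.
    rewrite enormZ gtr0_norm ?invr_gt0// mulrC ler_pM ?enorm_ge0 ?invr_ge0//.
    + exact: ltW.
    + by rewrite lef_pV2 ?posrE.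
  rewrite enormZ ger0_norm; last by nonneg.
  by rewrite ler_pM ?enorm_ge0// ?ler_pM//; nonneg.
move=> k; have := dX k.+1; have := fY k.+1; have := fY k; have := sgZ k.
rewrite -(f1S k.+1) => h1 h2 h3 h4; split; [rewrite /Z; lra..|].
by rewrite (le_trans (enormD _ _))//; have := FY k.+2; rewrite /Z in h1 *; lra.
Qed.

(** One null sequence for all the error terms, built from [loss]; the first two bounds need a square
    root. *)
Lemma step_errors : exists2 eta : nat -> R, eta @ \oo --> 0 & forall k, [/\
  0 <= eta k.+2, enorm (sg k.+3 - sg k.+2) <= eta k.+2,
  dotp (yv k.+2) (f k.+2) <= eta k.+2,
  alpha * rho k.+2 * dotp (f k.+2) (f1 k.+2) <= eta k.+2 &
  C k.+2 * dotp (yv k.+2) (yv k.+2) <= eta k.+2].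
Proof.
have [M M0 bM] := all_bounded; have loss0 := loss_cvg0 z zz.
have sq0 c : (fun k => Num.sqrt (c * loss k)) @ \oo --> 0.
  by apply: cvg0_sqrt; exact: cvg0Z.
exists (fun k => Num.sqrt (gmin ^- 2 * loss k) +
  Num.sqrt (M ^+ 2 / gmin ^+ 3 * loss k) + gmin ^- 2 * loss k).
  by apply: cvg0D; [apply: cvg0D; exact: sq0|exact: cvg0Z].
move=> i; have [dM fM _ _] := bM i; set k := i.+2 in dM fM *.
have [l0 l1 l2 l3 l4] := loss_parts k.
have s1 := sqrtr_ge0 (gmin ^- 2 * loss k).
have s2 := sqrtr_ge0 (M ^+ 2 / gmin ^+ 3 * loss k).
have g2 : 0 < gmin ^+ 2 by exact: exprn_gt0.
have s3 : 0 <= gmin ^- 2 * loss k by rewrite mulr_ge0// invr_ge0 ltW.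
have gg j : gmin ^+ 2 <= gamma j ^+ 2 by rewrite lerXn2r ?nnegrE// ltW.
split.
- by rewrite !addr_ge0.
- apply: (@le_trans _ _ (Num.sqrt (gmin ^- 2 * loss k))); last by lra.
  rewrite -(ger0_norm (enorm_ge0 _)) -sqrtr_sqr ler_wsqrtr// sqr_enorm.
  rewrite ler_pdivlMl//; apply: le_trans l1.
  by rewrite ler_wpM2r ?dotp_ge0.
- apply: (@le_trans _ _ (Num.sqrt (M ^+ 2 / gmin ^+ 3 * loss k))); last by lra.
  rewrite (le_trans (ler_norm _))// -sqrtr_sqr ler_wsqrtr//.
  set t := dotp _ _.
  have tg : gamma k * t = dotp (d k) (f k) by rewrite /t -dotpZl -yvE.
  have t0 : 0 <= t by rewrite -(pmulr_rge0 _ (gamma_gt0 k)) tg mono_dF.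
  have tM : gamma k * t <= M ^+ 2.
    by rewrite tg (le_trans (dotp_le _ _))// expr2 ler_pM ?enorm_ge0.
  (* Multiplied by [t] and combined with [gamma k * t <= M ^+ 2], this gives
     [t^2 <= M^2 loss / gmin^3], with no upper bound on [gamma k]. *)
  have tl : gmin ^+ 3 * t <= loss k * gamma k.
    have g3 : gmin ^+ 3 <= gamma k.+1 ^+ 3 by rewrite lerXn2r ?nnegrE// ltW.
    apply: (@le_trans _ _ (gamma k.+1 ^+ 3 * t)); first by rewrite ler_wpM2r.
    apply: (@le_trans _ _ (2 * alpha * rho k.+1 ^+ 3 * gamma k * (gamma k * t) * gamma k)).
      have -> : 2 * alpha * rho k.+1 ^+ 3 * gamma k * (gamma k * t) * gamma k =
        2 * alpha * (gamma k.+1 ^+ 3 * t) by rewrite gammaS; ring.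
      have : 0 <= gamma k.+1 ^+ 3 * t by rewrite mulr_ge0//; nonneg.
      by have := alpha_ge1; nra.
    by rewrite tg ler_wpM2r// ltW.
  rewrite -mulrA mulrC -mulrA ler_pdivlMl ?exprn_gt0//.
  apply: (@le_trans _ _ (loss k * gamma k * t)).
    by rewrite expr2 mulrA ler_wpM2r.
  by rewrite -mulrA ler_wpM2l.
- apply: (@le_trans _ _ (gmin ^- 2 * loss k)); last by lra.
  rewrite ler_pdivlMl//; set c := _ * dotp _ _.
  have [c0|/ltW c0] := leP c 0.
    by apply: le_trans l0; rewrite mulr_ge0_le0// ltW.
  apply: le_trans l4; rewrite -[leRHS]mulrA -/c.
  apply: (@le_trans _ _ (gamma k.+1 ^+ 2 * c)); first by rewrite ler_wpM2r.
  rewrite ler_wpM2r// -[leLHS]mulr1 ler_pM//; [by nonneg| |].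
    by rewrite -[leLHS]mul1r ler_wpM2r ?ler1n//; nonneg.
  by rewrite lerDl; nonneg.
- apply: (@le_trans _ _ (gmin ^- 2 * loss k)); last by lra.
  rewrite ler_pdivlMl//; apply: le_trans l2.
  rewrite yvE dotpZl dotpZr (mulrA (gamma k)) -expr2 mulrCA.
  rewrite ler_wpM2l ?C_ge0// ler_wpM2r ?dotp_ge0//.
Qed.

(** Solve the definition of [C] for [|d|^2 / 2], drop the terms of favourable sign, bound the ratios
    by [r] and divide by [gamma_k^2]. *)
Lemma yv_le (r e : R) k : 1 <= r -> (forall k, rho k <= r) -> 0 <= e ->
  dotp (yv k) (f1 k) <= e ->
  2^-1 * dotp (yv k) (yv k) <= C k * dotp (yv k) (yv k) +
    r ^+ 2 * (lambda / 2 * r ^+ 2 + (1 + alpha * r) ^+ 2 * (1 + mu)) *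
      dotp (f k) (f k) + r ^+ 3 * e.
Proof.
move=> r1 rr e0 ye.
set K1 := lambda / 2 * r ^+ 2 + _.
have r0 : 0 <= r by exact: le_trans r1.
have g0 := gamma_gt0 k; have rho0 := ltW (rho_gt0 k.+1).
have a0 := ltW alpha_gt0; have l0 := ltW lambda_gt0; have m0 := ltW mu_gt0.
rewrite -(ler_pM2l (exprn_gt0 2 g0)).
have dd : gamma k ^+ 2 * dotp (yv k) (yv k) = dotp (d k) (d k).
  by rewrite [in RHS]yvE dotpZl dotpZr expr2 mulrA.
have df1 : gamma k * dotp (yv k) (f1 k) = dotp (d k) (f1 k).
  by rewrite [in RHS]yvE dotpZl.
set Q := (gamma k.+1) ^+ 2 * (lambda / 2 * rho k.+1 ^+ 2 +
     (1 + alpha * rho k.+1) ^+ 2 * (1 + mu * negpart (cosphi F x k))) * dotp (f k) (f k).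
have CE : C k * dotp (d k) (d k) = 2^-1 * dotp (d k) (d k) - Q +
   (alpha - 1) * rho k.+1 ^+ 2 * dotp (d k) (d k) +
   2 * gamma k * rho k.+1 ^+ 2 * dotp (d k) (f k) -
   tau F x gamma rho eps k * alpha * eps * ((2 - alpha) / 2) *
  rho k.+1 ^+ 2 * dotp (d k) (d k).
  by rewrite /Q -ell_spec -L_spec /Ccoef; ring.
move: CE (tau_spec k); move: (tau _ _ _ _ _ _) => t.
set T := t * _ * _ * _ * _ * _ => CE tauE.
have h1 : 0 <= (alpha - 1) * rho k.+1 ^+ 2 * dotp (d k) (d k).
  by rewrite !mulr_ge0 ?subr_ge0 ?dotp_ge0 ?sqr_ge0.
have h2 : 0 <= 2 * gamma k * rho k.+1 ^+ 2 * dotp (d k) (f k) by nonneg.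
have rr2 : rho k.+1 ^+ 2 <= r ^+ 2 by rewrite lerXn2r ?nnegrE.
have hQ : Q <= gamma k ^+ 2 * (r ^+ 2 * K1 * dotp (f k) (f k)).
  rewrite /Q gammaS exprMn mulrA ler_wpM2r ?dotp_ge0//.
  rewrite [leRHS]mulrCA [leRHS]mulrA ler_pM//; last 1 first.
  - rewrite /K1 lerD//.
      by rewrite ler_wpM2l// divr_ge0.
    rewrite ler_pM//; [by nonneg| | |].
    + by rewrite addr_ge0// mulr_ge0// /negpart le_max lexx orbT.
    + by rewrite lerXn2r ?nnegrE ?lerD2l ?ler_wpM2l ?addr_ge0 ?mulr_ge0.
    + by rewrite lerD2l -[leRHS]mulr1 ler_wpM2l// cos_ge.
  - by nonneg.
  - apply: addr_ge0; first by nonneg.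
    apply: mulr_ge0; first by nonneg.
    by rewrite addr_ge0// mulr_ge0// /negpart le_max lexx orbT.
  - by rewrite ler_wpM2r// sqr_ge0.
(* For [tau <= 0] the term is nonpositive. Otherwise [tau_spec] bounds [tau * (eps / 2) * |d|^2] by
   [gamma_k rho_k <d, f1>], and the assumption on [<yv, f1>] applies. *)
have hT : T <= gamma k ^+ 2 * (r ^+ 3 * e).
  have ge0 : 0 <= gamma k ^+ 2 * (r ^+ 3 * e) by nonneg.
  have [t0|/ltW t0] := leP t 0.
    apply: le_trans ge0.
    have -> : T = t * (alpha * eps * ((2 - alpha) / 2) * rho k.+1 ^+ 2 *
      dotp (d k) (d k)) by rewrite /T; ring.
    apply: mulr_le0_ge0 => //.
    by have a2 : 0 <= 2 - alpha; [rewrite subr_ge0|nonneg].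
  have tE := tauE; rewrite mulrDr in tE.
  have tD : t * (eps / 2 * dotp (d k) (d k)) <= gamma k * rho k * dotp (d k) (f1 k).
    rewrite -tE lerDl; apply: mulr_ge0 => //; apply: mulr_ge0; last exact: dotp_ge0.
    by apply: mulr_ge0; [exact: sqr_ge0|rewrite invr_ge0 mulr_ge0// ltW].
  have tF : gamma k * rho k * dotp (d k) (f1 k) <= gamma k ^+ 2 * (r * e).
    rewrite -df1.
    have -> : gamma k * rho k * (gamma k * dotp (yv k) (f1 k)) =
      gamma k ^+ 2 * (rho k * dotp (yv k) (f1 k)) by ring.
    rewrite ler_wpM2l ?sqr_ge0//; apply: (@le_trans _ _ (rho k * e)).
      by rewrite ler_wpM2l// ltW// rho_gt0.
    by rewrite ler_wpM2r.
  have -> : T = alpha * (2 - alpha) * rho k.+1 ^+ 2 * (t * (eps / 2 * dotp (d k) (d k))).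
    by rewrite /T; ring.
  have aa0 : 0 <= alpha * (2 - alpha) by rewrite mulr_ge0// subr_ge0.
  have aa1 : alpha * (2 - alpha) <= 1 by have := sqr_ge0 (alpha - 1); lra.
  have arr : alpha * (2 - alpha) * rho k.+1 ^+ 2 <= r ^+ 2.
    by rewrite -[leRHS]mul1r ler_pM ?sqr_ge0.
  apply: (@le_trans _ _ (alpha * (2 - alpha) * rho k.+1 ^+ 2 * (gamma k ^+ 2 * (r * e)))).
    by rewrite ler_wpM2l ?(le_trans tD)// mulr_ge0// sqr_ge0.
  have -> : gamma k ^+ 2 * (r ^+ 3 * e) = r ^+ 2 * (gamma k ^+ 2 * (r * e)) by ring.
  by rewrite ler_wpM2r//; nonneg.
have CE2 : gamma k ^+ 2 * (C k * dotp (yv k) (yv k)) = C k * dotp (d k) (d k).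
  by rewrite mulrCA dd.
have h3 : gamma k ^+ 2 * (2^-1 * dotp (yv k) (yv k)) = 2^-1 * dotp (d k) (d k).
  by rewrite mulrCA dd.
rewrite h3 mulrDr mulrDr CE2 CE; lra.
Qed.

(** Expand the square of [res k + f k.+1 + v] with [v] small. By [yv_res], [<res k, f k.+1>] is
    minus the two pairings bounded by [e'], up to a term in [v]. *)
Lemma res_step (e e' M : R) k : enorm (sg k.+1 - sg k) <= e ->
  alpha * rho k.+1 * dotp (f k.+1) (f1 k.+1) <= e' ->
  dotp (yv k.+1) (f k.+1) <= e' ->
  enorm (res k) <= M -> enorm (f k.+1) <= M ->
  dotp (res k) (res k) + dotp (f k.+1) (f k.+1) - (4 * e' + 6 * M * e) <=
    dotp (res k.+1) (res k.+1).
Proof.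
rewrite f1S yv_res res_next.
move: (res k) (f k.+1) (f k) (sg k.+1 - sg k) => u w w1 v ve h1 h2 uM wM.
have M0 : 0 <= M by apply: le_trans uM; exact: enorm_ge0.
have bnd q : enorm q <= M -> `|dotp q v| <= M * e.
  by move=> qM; rewrite (le_trans (norm_dotp_le _ _))// ler_pM ?enorm_ge0.
have := bnd _ uM; have := bnd _ wM; rewrite !ler_norml => /andP[b1 b2] /andP[b3 b4].
have v0 := dotp_ge0 v.
move: h2; rewrite !dotpE (dotpC w1 w) (dotpC v w) (dotpC v u) (dotpC w u).
by move: h1; lra.
Qed.

Lemma res_le (e c : R) k : enorm (sg k.+1 - sg k) <= e -> alpha * rho k.+1 <= c ->
  dotp (res k) (res k) <=
    3 * (dotp (yv k.+1) (yv k.+1) + c ^+ 2 * dotp (f k) (f k) + e ^+ 2).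
Proof.
move=> ve ac; have -> : res k = - yv k.+1 - (alpha * rho k.+1) *: f k -
    (sg k.+1 - sg k).
  by rewrite yv_res; apply/rowP => i; rewrite !mxE; ring.
move: (sg k.+1 - sg k) ve => v ve.
have a0 : 0 <= alpha * rho k.+1 by nonneg.
have c2 : (alpha * rho k.+1) ^+ 2 * dotp (f k) (f k) <= c ^+ 2 * dotp (f k) (f k).
  by rewrite ler_wpM2r ?dotp_ge0// lerXn2r ?nnegrE// (le_trans a0).
have e2 : dotp v v <= e ^+ 2.
  by rewrite -sqr_enorm lerXn2r ?nnegrE ?enorm_ge0// (le_trans (enorm_ge0 v)).
move: c2; rewrite expr2 -mulrA -dotpZr -dotpZl.
move: (c ^+ 2 * _) (_ *: f k) (yv k.+1) => B2 u y c2.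
have := dotp_ge0 (u - y); have := dotp_ge0 (v - y); have := dotp_ge0 (u - v).
rewrite !dotpE (dotpC v u) (dotpC y u) (dotpC y v).
lra.
Qed.

(** Pair [yv_next] with [f k]: the term in [|f k|^2] has a favourable sign. This supplies the
    assumption of [yv_le] at the next index. *)
Lemma yv_f1_le (e M : R) k : enorm (sg k.+1 - sg k) <= e ->
  dotp (yv k) (f k) <= e -> alpha * rho k * dotp (f k) (f1 k) <= e ->
  enorm (f k) <= M -> dotp (yv k.+1) (f1 k.+1) <= (2 + M) * e.
Proof.
rewrite f1S yv_next.
have h4 : 0 <= (1 + alpha * rho k.+1) * dotp (f k) (f k) by nonneg.
move: (1 + _) (f k) (f1 k) (yv k) (sg k.+1 - sg k) h4 => c u u1 y v h4 ve h1 h2 uM.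
have h3 : - dotp v u <= M * e.
  rewrite -dotpNl (le_trans (dotp_le _ _))// enormN mulrC.
  by rewrite ler_pM ?enorm_ge0.
by rewrite !dotpE (dotpC u1); lra.
Qed.

(* The squared residuals dominate [|f k|^2] in their increments, while [|f|]
   over two steps controls the residual itself. *)
Lemma res_cvg0 : (fun k => dotp (res k) (res k)) @ \oo --> 0.
Proof.
have [M M0 bM] := all_bounded; have [eta eta0 etaP] := step_errors.
have [r r1 rr] := rho_bounded.
pose K1 := r ^+ 2 * (lambda / 2 * r ^+ 2 + (1 + alpha * r) ^+ 2 * (1 + mu)).
have r0 : 0 < r by exact: lt_le_trans r1.
have K10 : 0 <= K1.
  by have ? := ltW r0; rewrite /K1; nonneg.
(* Inserting [yv_le] into [res_le] with [c = 2 r] gives coefficients [12 r^2] and [6 K1] for two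
   consecutive squares [|f|^2]; [K2] exceeds neither less than their sum, and [e2] collects the
   errors. *)
pose K2 := 6 * K1 + 12 * r ^+ 2.
have K20 : 0 < K2.
  by apply: ltr_wpDl; [rewrite mulr_ge0|apply: mulr_gt0 => //; exact: exprn_gt0].
pose e1 k := 4 * eta k.+1 + 6 * M * eta k.
pose e2 k := 3 * (2 * eta k.+1 + 2 * r ^+ 3 * (2 + M) * eta k + eta k ^+ 2).
have e10 : e1 @ \oo --> 0.
  by apply: cvg0D; apply: cvg0Z => //; exact: cvg0S.
have e20 : e2 @ \oo --> 0.
  apply: cvg0Z; apply: cvg0D; first by apply: cvg0D; apply: cvg0Z => //; exact: cvg0S.
  by rewrite -(mulr0 0); apply: cvgM.
pose err k := e1 k + e1 k.+1 + K2^-1 * (e1 k + e2 k.+1).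
apply: (growth_cvg0 _ err (M ^+ 2) K2^-1); first by rewrite invr_gt0.
- exists 2%N => //= -[|[|k]] // _; have [_ _ _ rM] := bM k.
  by rewrite dotp_ge0 -sqr_enorm lerXn2r ?nnegrE ?enorm_ge0 ?(ltW M0).
- apply: cvg0D; first by apply: cvg0D => //; exact: cvg0S.
  by apply: cvg0Z; apply: cvg0D => //; exact: cvg0S.
exists 2%N => //= -[|[|k]] // _.
have [n0 d0 t0 c0 C0] := etaP k; have [n1 d1 t1 c1 C1] := etaP k.+1.
have [n2 d2 t2 c2 C2] := etaP k.+2.
have [_ f0M _ r0M] := bM k; have [_ f1M _ r1M] := bM k.+1.
have [_ f2M _ _] := bM k.+2.
(* Two consecutive steps add the two squares [|f|^2] that together control the residual at
   [k + 3]. *)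
have s1 := res_step _ _ _ k.+2 d0 c1 t1 r0M f1M.
have s2 := res_step _ _ _ k.+3 d1 c2 t2 r1M f2M.
have ar : alpha * rho k.+4 <= 2 * r by rewrite ler_pM//; nonneg.
have s3 := res_le _ _ k.+3 d1 ar.
have yf := yv_f1_le _ _ k.+3 d1 t1 c1 f1M.
have s4 := yv_le r _ k.+4 r1 rr (_ : 0 <= (2 + M) * eta k.+3) yf.
have {}s4 := s4 (mulr_ge0 (addr_ge0 (ler0n _ 2) (ltW M0)) n1).
rewrite -/K1 in s4.
have f10 := dotp_ge0 (f k.+3); have f20 := dotp_ge0 (f k.+4).
have key : K2^-1 * (dotp (res k.+3) (res k.+3) - e2 k.+3) <=
    dotp (f k.+3) (f k.+3) + dotp (f k.+4) (f k.+4).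
  rewrite ler_pdivrMl// /e2 /K2.
  have r2 := sqr_ge0 r.
  have q1 : 0 <= r ^+ 2 * dotp (f k.+4) (f k.+4) by exact: mulr_ge0.
  have q2 : 0 <= K1 * dotp (f k.+3) (f k.+3) by exact: mulr_ge0.
  move: s3 s4; rewrite exprMn; move: C2; set CC := C k.+4 * _; lra.
have e1k : dotp (res k.+2) (res k.+2) - e1 k.+2 <= dotp (res k.+3) (res k.+3).
  by rewrite /e1; lra.
have := ler_wpM2l (_ : 0 <= K2^-1) e1k; rewrite invr_ge0 => /(_ (ltW K20)).
rewrite /err; move: key; rewrite /e1; lra.
Qed.

Lemma enorm_res_cvg0 : (fun k => enorm (res k)) @ \oo --> 0.
Proof. exact: cvg0_sqrt res_cvg0. Qed.

Lemma Vr_cvg0 : (fun k : nat => Vr k%:Z z) @ \oo --> 0.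
Proof.
have [M xM] := iterates_bounded z zz.
apply: (cvg0_le _ (fun k => M * enorm (res k))); last first.
  by apply: cvg0Z; exact: enorm_res_cvg0.
exists 1%N => //= -[|k] // _; rewrite ger0_norm; last exact: Vr_ge0 (edomS k).
apply: le_trans (Vr_le_res k z zz) _; apply: le_trans (dotp_le _ _) _.
by rewrite mulrC ler_wpM2r ?enorm_ge0.
Qed.

Lemma iterates_cluster_zerT y : cluster ((fun k : nat => xn k) @ \oo) y -> zerT F g y.
Proof.
move=> yc; have [M xM] := xn_bounded z zz.
apply: (cluster_zerT _ _ _ _ F_lip g_proper g_convex g_lsc yc) => u gu.
exists (fun k => (M + enorm u) * enorm (res k)).
  by apply: cvg0Z; exact: enorm_res_cvg0.
exists 1%N => //= -[|k] // _.
have sub := subgradient_fine g_proper (step_subgradient k.+1 (x_step k)) gu.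
rewrite -(edom_fineK g_proper gu) -(edom_fineK g_proper (edomS k)).
rewrite -!EFinD lee_fin.
have mon := F_mono (xn k.+1) u.
have rb : dotp (res k.+1) (xn k.+1 - u) <= (M + enorm u) * enorm (res k.+1).
  rewrite (le_trans (dotp_le _ _))// mulrC ler_wpM2r ?enorm_ge0//.
  by rewrite (le_trans (enormB _ _))// lerD2r.
move: rb; rewrite /res dotpDl; move: sub mon; rewrite -(opprB (xn k.+1) u) dotpNr.
by rewrite dotpDl dotpNl; lra.
Qed.

(** [1 + tau] times the scaled denominator is [|eps d + rho gamma f1|^2 / (2 eps)]. *)
Lemma tau_geN1 k : -1 <= tau F x gamma rho eps k.
Proof.
have [/andP[/eqP dk /eqP fk]|df] := boolP ((d k == 0) && (f1 k == 0)).
  by rewrite /tau dk fk dotp0r mul0r; lra.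
have den : 0 < eps / 2 * dotp (d k) (d k) + (rho k * gamma k) ^+ 2 / (2 * eps) *
      dotp (f1 k) (f1 k).
  by apply: tau_den_gt0; move: df; rewrite negb_and => /orP.
rewrite -(ler_pM2r den) tau_spec mulN1r -subr_ge0 opprK.
have -> : gamma k * rho k * dotp (d k) (f1 k) + (eps / 2 * dotp (d k) (d k) +
    (rho k * gamma k) ^+ 2 / (2 * eps) * dotp (f1 k) (f1 k)) =
  (2 * eps)^-1 * dotp (eps *: d k + (rho k * gamma k) *: f1 k)
                      (eps *: d k + (rho k * gamma k) *: f1 k).
  move: (d k) (f1 k) => u v; rewrite !dotpE (dotpC v u); field.
  by rewrite gt_eqF.
by rewrite mulr_ge0 ?dotp_ge0// invr_ge0 mulr_ge0// ltW.
Qed.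

(** [C >= 0] bounds [E], whose coefficient is at least 1, by multiples of [|d|^2] and a pairing
    [<d, f>]; Young's inequality absorbs the pairing at the price of [E / 2]. Continuity of [F]
    would not do, since [gamma] may be unbounded. *)
Lemma scaled_f_le r k : 1 <= r -> (forall k, rho k <= r) ->
  gamma k.+1 ^+ 2 * dotp (f k) (f k) <=
    (1 + 6 * r ^+ 2 + 2 * eps * r ^+ 2) * dotp (d k) (d k).
Proof.
move=> r1 rr; have r0 : 0 <= r by exact: le_trans r1.
have a0 := ltW alpha_gt0; have D0 := dotp_ge0 (d k); have f0 := dotp_ge0 (f k).
have CD : 0 <= C k * dotp (d k) (d k) by nonneg.
have tN := tau_geN1 k.
set E := gamma k.+1 ^+ 2 * _; have E0 : 0 <= E by rewrite /E; nonneg.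
have CE : C k * dotp (d k) (d k) = 2^-1 * dotp (d k) (d k) -
   E * (lambda / 2 * rho k.+1 ^+ 2 +
     (1 + alpha * rho k.+1) ^+ 2 * (1 + mu * negpart (cosphi F x k))) +
   (alpha - 1) * rho k.+1 ^+ 2 * dotp (d k) (d k) +
   2 * rho k.+1 * (gamma k.+1 * dotp (d k) (f k)) -
   alpha * (2 - alpha) * eps / 2 * (tau F x gamma rho eps k *
     (rho k.+1 ^+ 2 * dotp (d k) (d k))).
  by rewrite /E -ell_spec -L_spec /Ccoef gammaS; ring.
have coef : 1 <= lambda / 2 * rho k.+1 ^+ 2 +
     (1 + alpha * rho k.+1) ^+ 2 * (1 + mu * negpart (cosphi F x k)).
  apply: ler_wpDl; first by have ? := ltW lambda_gt0; nonneg.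
  have q1 : 1 <= 1 + alpha * rho k.+1 by rewrite lerDl; nonneg.
  have q2 : 1 <= 1 + mu * negpart (cosphi F x k).
    by rewrite lerDl; apply: mulr_ge0 (ltW mu_gt0) (negpart_ge0 _).
  by rewrite -[leLHS]mulr1 ler_pM// expr_ge1// (le_trans ler01).
have EC := ler_wpM2l E0 coef; rewrite mulr1 in EC.
have rr2 : rho k.+1 ^+ 2 * dotp (d k) (d k) <= r ^+ 2 * dotp (d k) (d k).
  by rewrite ler_wpM2r// lerXn2r ?nnegrE// ltW ?rho_gt0.
have rD : 0 <= rho k.+1 ^+ 2 * dotp (d k) (d k) by nonneg.
have h1 : (alpha - 1) * rho k.+1 ^+ 2 * dotp (d k) (d k) <= r ^+ 2 * dotp (d k) (d k).
  have a2 : 0 <= 2 - alpha by rewrite subr_ge0.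
  by have := mulr_ge0 a2 rD; move: rr2; lra.
have h2 : 2 * rho k.+1 * (gamma k.+1 * dotp (d k) (f k)) <=
    2^-1 * E + 2 * (rho k.+1 ^+ 2 * dotp (d k) (d k)).
  rewrite -subr_ge0.
  have -> : 2^-1 * E + 2 * (rho k.+1 ^+ 2 * dotp (d k) (d k)) -
     2 * rho k.+1 * (gamma k.+1 * dotp (d k) (f k)) =
     2^-1 * dotp (gamma k.+1 *: f k - (2 * rho k.+1) *: d k)
                 (gamma k.+1 *: f k - (2 * rho k.+1) *: d k).
    by rewrite /E; move: (f k) (d k) => u v; rewrite !dotpE (dotpC u v); lra.
  by rewrite mulr_ge0 ?dotp_ge0.
have aa0 : 0 <= alpha * (2 - alpha) * eps / 2.
  by have a2 : 0 <= 2 - alpha; [rewrite subr_ge0|nonneg].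
have aa1 : alpha * (2 - alpha) * eps / 2 <= eps.
  by have := mulr_ge0 (ltW eps_gt0) (sqr_ge0 (alpha - 1)); move: eps_gt0; lra.
have h3 : - (alpha * (2 - alpha) * eps / 2 * (tau F x gamma rho eps k *
     (rho k.+1 ^+ 2 * dotp (d k) (d k)))) <= eps * (r ^+ 2 * dotp (d k) (d k)).
  rewrite -mulrN -mulNr.
  apply: (@le_trans _ _ (alpha * (2 - alpha) * eps / 2 *
      (1 * (rho k.+1 ^+ 2 * dotp (d k) (d k))))).
    by rewrite ler_wpM2l// ler_wpM2r// lerNl.
  by rewrite mul1r ler_pM.
rewrite CE in CD; lra.
Qed.

Lemma Vk_cvg0 : (fun k : nat => Vk F g x k%:Z z) @ \oo --> 0%E.
Proof.
have : (fun k : nat => (Vr k%:Z z)%:E) @ \oo --> 0%E.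
  by apply: cvg_EFin; [exact: nearW|exact: Vr_cvg0].
apply: cvg_trans; apply: near_eq_cvg.
exists 1%N => //= -[|k] // _; rewrite Vk_fin//; first exact: edomS.
exact: zerT_edom.
Qed.

(** * Convergence of the iterates when [C] stays away from 0 *)

Section CBoundedBelow.
Context (c : R).
Hypotheses (c_gt0 : 0 < c) (C_ge : \forall k \near \oo, c <= C k).

Lemma d_cvg0 : (fun k => dotp (d k) (d k)) @ \oo --> 0.
Proof.
apply: (cvg0_le _ (fun k => c^-1 * loss k)); last first.
  by apply: cvg0Z; exact: (loss_cvg0 z).
near=> k; have [_ _ CD _ _] := loss_parts k.
rewrite ger0_norm ?dotp_ge0// ler_pdivlMl//; apply: le_trans CD.
by rewrite ler_wpM2r ?dotp_ge0//; near: k.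
Unshelve. all: by end_near. Qed.

Lemma scaled_f_cvg0 : (fun k => gamma k.+1 ^+ 2 * dotp (f k) (f k)) @ \oo --> 0.
Proof.
have [r r1 rr] := rho_bounded.
apply: (cvg0_le _ (fun k => (1 + 6 * r ^+ 2 + 2 * eps * r ^+ 2) * dotp (d k) (d k))).
  apply: nearW => k; rewrite ger0_norm; last by nonneg.
  exact: scaled_f_le.
by apply: cvg0Z; exact: d_cvg0.
Qed.

(* [gamma_{k+1} V_k <= gamma_{k+1} <res k, x^k - y>], and [gamma_{k+1} res k]
   vanishes even when [gamma] is unbounded. *)
Lemma Ur_dist_cvg0 y : zerT F g y ->
  (fun k => Ur k.+1 y - 2^-1 * enorm (xn k.+1 - y) ^+ 2) @ \oo --> 0.
Proof.
move=> yy; have [r r1 rr] := rho_bounded.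
have [M xM] := iterates_bounded y yy.
pose gf k := Num.sqrt (gamma k.+1 ^+ 2 * dotp (f k) (f k)).
pose gs k := Num.sqrt (gamma k.+1 ^+ 2 * dotp (sg k.+1 - sg k) (sg k.+1 - sg k)).
pose q k := enorm (d k.+1) + (2 * r * gf k + gs k).
have r0 : 0 <= r by exact: le_trans r1.
have M0 : 0 <= M by apply: le_trans (xM 0%N); exact: enorm_ge0.
have sqrtE k u : Num.sqrt (gamma k ^+ 2 * dotp u u) = gamma k * enorm (u : 'rV[R]_n).
  by rewrite sqrtrM ?sqr_ge0// sqrtr_sqr gtr0_norm.
have q0 : q @ \oo --> 0.
  apply: cvg0D.
    by apply: (cvg0S (fun k => enorm (d k))); apply: cvg0_sqrt; exact: d_cvg0.
  apply: cvg0D; first by apply: cvg0Z; apply: cvg0_sqrt; exact: scaled_f_cvg0.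
  apply: cvg0_sqrt; apply: (cvg0_le _ loss); last exact: (loss_cvg0 z).
  apply: nearW => k; have [_ h _ _ _] := loss_parts k.
  by rewrite ger0_norm//; nonneg.
apply: (cvg0_le _ (fun k => 2^-1 * dotp (d k.+1) (d k.+1) +
   (lambda / 2 * r ^+ 2 * (gamma k.+1 ^+ 2 * dotp (f k) (f k)) +
    (1 + 2 * r) * M * q k))); last first.
  apply: cvg0D.
    by apply: cvg0Z; apply: (cvg0S (fun k => dotp (d k) (d k))); exact: d_cvg0.
  by apply: cvg0D; apply: cvg0Z => //; exact: scaled_f_cvg0.
exists 1%N => //= -[|k] // _.
have V0 : 0 <= Vr k.+1%:Z y by apply: Vr_ge0 => //; exact: edomS.
have w0 := weight_gt0 k.+2.
have -> : Ur k.+2 y - 2^-1 * enorm (xn k.+2 - y) ^+ 2 =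
  2^-1 * dotp (d k.+2) (d k.+2) +
  (lambda / 2 * rho k.+2 ^+ 2 * (gamma k.+2 ^+ 2 * dotp (f k.+1) (f k.+1)) +
   (1 + alpha * rho k.+2) * (gamma k.+2 * Vr k.+1%:Z y)).
  rewrite /Ur subSZ1 !sqr_enorm; ring.
have l0 := ltW lambda_gt0.
rewrite ger0_norm; last by nonneg.
rewrite lerD2l lerD//.
  rewrite ler_wpM2r; [by []|by nonneg|].
  by rewrite ler_wpM2l ?divr_ge0// lerXn2r ?nnegrE// ltW ?rho_gt0.
rewrite -mulrA ler_pM//; [by nonneg|by nonneg|by rewrite lerD2l ler_pM//; nonneg|].
apply: (@le_trans _ _ (dotp (gamma k.+2 *: res k.+1) (xn k.+1 - y))).
  by rewrite dotpZl ler_pM2l// Vr_le_res.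
apply: le_trans (dotp_le _ _) _; rewrite mulrC ler_pM ?enorm_ge0//.
have -> : gamma k.+2 *: res k.+1 = - d k.+2 -
    ((alpha * rho k.+2) *: (gamma k.+2 *: f k.+1) +
     gamma k.+2 *: (sg k.+2 - sg k.+1)).
  rewrite yvE yv_res.
  move: (res k.+1) (f k.+1) (sg k.+2 - sg k.+1) => u v w.
  by apply/rowP => i; rewrite !mxE; ring.
apply: le_trans (enormB _ _) _; rewrite enormN /q lerD2l.
apply: le_trans (enormD _ _) _; rewrite /gf /gs !sqrtE !enormZ.
rewrite !(gtr0_norm (gamma_gt0 _)) lerD2r ger0_norm; last by nonneg.
rewrite ler_wpM2r//; first by nonneg.
by rewrite ler_pM//; nonneg.
Qed.

(** Near the cluster point both the distance and the rest of [Ur] are small, so [Ur] falls below [e]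
    once, and by monotonicity for good. *)
Lemma Ur_cluster_cvg0 y : zerT F g y -> cluster ((fun k : nat => xn k) @ \oo) y ->
  (fun k => Ur k y) @ \oo --> 0.
Proof.
move=> yy yc; apply/cvgrPdist_lt => e e0; have e2 : 0 < e / 2 by rewrite divr_gt0.
have [N _ NP] : \forall k \near \oo,
    Ur k.+1 y - 2^-1 * enorm (xn k.+1 - y) ^+ 2 < e / 2.
  exact: (cvgr_lt 0 (Ur_dist_cvg0 y yy)).
have se0 : 0 < Num.sqrt e by rewrite sqrtr_gt0.
have [k Nk /= ke] := cluster_seqE N.+2 yc (nbhs_enorm y _ se0).
case: k Nk ke => [|[|k]] // Nk ke.
have Uk_e : Ur k.+2 y < e.
  have : enorm (xn k.+2 - y) ^+ 2 < e.
    by rewrite -[ltRHS](sqr_sqrtr (ltW e0)) ltrXn2r ?nnegrE ?enorm_ge0.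
  by have := NP k.+1 (ltnW Nk); lra.
exists k.+2 => //= j kj; rewrite sub0r normrN ger0_norm.
  by apply: le_lt_trans Uk_e; apply: Ur_noninc => //; exact: edomSB.
by case: j kj => [|[|j]] // _; apply: Ur_ge0 => //; exact: edomSB.
Qed.

(** A cluster point exists by boundedness and is a solution; [Ur] centred there tends to 0 and
    dominates the squared distance. *)
Lemma iterates_cvg : exists y, [/\ zerT F g y,
  (fun k : nat => xn k) @ \oo --> y &
  (fun k => Uk F g x gamma rho alpha lambda k y) @ \oo --> 0%E].
Proof.
have [M xM] := xn_bounded z zz; have [y yc] := bounded_seq_cluster xM.
have yy := iterates_cluster_zerT y yc; have U0 := Ur_cluster_cvg0 y yy yc.
exists y; split=> //.
  have n0 : (fun k : nat => enorm (xn k - y)) @ \oo --> 0.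
    apply: (cvg0_le _ (fun k => Num.sqrt (2 * Ur k y))); last first.
      by apply: cvg0_sqrt; exact: cvg0Z.
    exists 2%N => //= -[|[|k]] // _; rewrite ger0_norm ?enorm_ge0//.
    rewrite -[leLHS](ger0_norm (enorm_ge0 _)) -sqrtr_sqr ler_wsqrtr//.
    rewrite -ler_pdivrMl//; apply: le_trans (dist_le_Ur k.+2 y).
    rewrite lerDl mulr_ge0 ?(ltW (weight_gt0 _))// Vr_ge0//; exact: edomSB.
  apply/(@cvgrPdist_lt R 'rV[R]_n) => e e0; near=> k; rewrite distrC.
  apply: le_lt_trans (norm_le_enorm _) _.
  by near: k; exact: (cvgr_lt 0).
have : (fun k => (Ur k y)%:E) @ \oo --> 0%E.
  by apply: cvg_EFin; [exact: nearW|exact: U0].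
apply: cvg_trans; apply: near_eq_cvg.
exists 2%N => //= -[|[|k]] // _; rewrite Uk_fin//; first exact: edomSB.
exact: zerT_edom.
Unshelve. all: by end_near. Qed.

End CBoundedBelow.
End StepsBoundedBelow.
End Method.

Theorem theorem3p4 (R : realType) (n : nat)
    (F : 'rV[R]_n -> 'rV[R]_n) (g : 'rV[R]_n -> \bar R)
    (x : int -> 'rV[R]_n) (gamma rho : nat -> R)
    (alpha eps mu lambda : R)
    (F_mono : monotone_op F) (F_lip : locally_lipschitz F)
    (g_proper : proper_fun g) (g_convex : econvex g)
    (g_lsc : lower_semicontinuous g)
    (zer_nonempty : zerT F g !=set0)
    (alpha_ge1 : 1 <= alpha) (alpha_le2 : alpha <= 2)
    (eps_gt0 : 0 < eps) (mu_gt0 : 0 < mu) (lambda_gt0 : 0 < lambda)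
    (gamma_gt0 : forall k, 0 < gamma k) (rho0_gt0 : 0 < rho 0%N)
    (rhoE : forall k, rho k.+1 = gamma k.+1 / gamma k)
    (x_step : forall k, prox_step F g x gamma rho alpha k.+1)
    (A_ge0 : forall k, 0 <= Acoef rho alpha k)
    (B_ge0 : forall k, 0 <= Bcoef F x gamma rho alpha eps mu lambda k)
    (C_ge0 : forall k, 0 <= Ccoef F x gamma rho alpha eps mu lambda k)
    (xs : 'rV[R]_n) (xs_sol : zerT F g xs) :
  let V_ (k : nat) := Vk F g x k%:Z in
  let U_ := Uk F g x gamma rho alpha lambda in
  let xb := xbar x gamma rho alpha in
  let delta := sup (range (fun k : nat => enorm (x k%:Z - xs))) in
  [/\ (* the descent from k = 0 needs x^0 to be itself a prox step *)
      [/\ forall k, (0 <= U_ k.+1 xs)%E,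
          forall k, (0 < k)%N -> (U_ k.+1 xs <= U_ k xs)%E,
          prox_step F g x gamma rho alpha 0%N -> (U_ 1%N xs <= U_ 0%N xs)%E
        & bounded_fun (fun k : nat => x k%:Z)],
      forall K,
        (0 <= minV F g x K xs)%E /\
        (minV F g x K xs
           <= U_ 1%N xs * ((\sum_(1 <= k < K.+2) gamma k)^-1)%:E)%E,
      ((\sum_(0 <= k <oo) (gamma k)%:E = +oo)%E ->
         [/\ limn_einf (fun k => V_ k xs) = 0%E,
             bounded_fun xb
           & forall y, cluster (xb @ \oo) y -> zerT F g y]) /\
      (forall K, (1 <= K)%N ->
         (Gap F g xs delta (xb K)
            <= ereal_sup [set U_ 2%N z | z in edom g `&` ecball xs delta]
               * ((\sum_(1 <= k < K.+1) gamma k.+1)^-1)%:E)%E)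
    & 0 < inf (range gamma) ->
        (fun k => V_ k xs) @ \oo --> 0%E /\
        ((0 < limn_einf
                (fun k => (Ccoef F x gamma rho alpha eps mu lambda k)%:E))%E ->
           exists xoo, [/\ zerT F g xoo,
             (fun k : nat => x k%:Z) @ \oo --> xoo
           & (fun k => U_ k xoo) @ \oo --> 0%E])].
Proof.
move=> V_ U_ xb delta; split.
- split.
  + move=> k; apply: Uk_ge0 => //; eassumption.
  + move=> [|k] // _; eapply Uk_descent;
        try exact B_ge0; try exact C_ge0; try eassumption; exact: x_step.
  + move=> x0; eapply Uk_descent;
        try exact B_ge0; try exact C_ge0; eassumption.
  + have [M xM] : exists M, forall k : nat, enorm (x k%:Z) <= M.
      eapply xn_bounded;
        try exact B_ge0; try exact C_ge0; eassumption.
    exact: bounded_fun_enorm xM.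
- move=> K; split.
  + by apply: le_bigmin => // i _; apply: Vk_ge0.
  + eapply minV_bound;
        try exact B_ge0; try exact C_ge0; eassumption.
- split.
  + move=> goo; split.
    * eapply liminf_gap;
        try exact B_ge0; try exact C_ge0; eassumption.
    * eapply xbar_bounded;
        try exact B_ge0; try exact C_ge0; eassumption.
    * move=> y yc; eapply xbar_cluster_zerT;
        try exact B_ge0; try exact C_ge0; eassumption.
  + move=> K K1; eapply Gap_bound;
        try exact B_ge0; try exact C_ge0; try eassumption.
    eapply radius_ge0;
        try exact B_ge0; try exact C_ge0; eassumption.
- move=> inf_gt0.
  (* The infimum serves as the constant [gmin]. *)
  have gmin_le k : inf (range gamma) <= gamma k.
    by apply: ge_inf; [exists 0 => _ [j _ <-]; exact: ltW|exists k].
  split.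
  + eapply Vk_cvg0;
        try exact gmin_le; try exact B_ge0; try exact C_ge0; eassumption.
  + move=> /limn_einf_gt0[c c0 Cc]; eapply iterates_cvg;
        try exact gmin_le; try exact B_ge0; try exact C_ge0; eassumption.
Qed.
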